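(* Let $p=1$ and let $k\ge1$ be the level of the Chern-Simons matrix model (so $\epsilon_1=1$, $\epsilon_2=k+1$). The operators $$\tilde t_{m,n}=\left((k+1)N\right)^{-\frac{m+n+2\delta_{m,n}}2}t_{m,n}\qquad(m,n\ge0)$$ converge in the large $N$ limit. For $m\neq n$ the limit $\lim_{N\to\infty}\tilde t_{m,n}$ depends only on $m-n$; put $\tilde\alpha_{m-n}:=\lim_{N\to\infty}\tilde t_{m,n}$ for $m\ne n$. Then the operators $\{\tilde\alpha_n,\ n\ne0\}$ form a $\widehat{\mathfrak u}(1)_{\frac1{k+1}}$ current algebra, i.e. $[\tilde\alpha_n,\tilde\alpha_m]=\frac1{k+1}\,n\,\delta_{n,-m}$, represented on the bosonic Fock space $\mathbb C[\tilde p_1,\tilde p_2,\tilde p_3,\dots]$.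
   Context: Operators. For $N\ge1$ consider operators $Z^i_j,Z^{\dagger i}_j,\lambda^i,\lambda^\dagger_i$ ($1\le i,j\le N$) with $[Z^i_j,Z^{\dagger k}_l]=\delta^i_l\delta^k_j$, $[\lambda^j,\lambda^\dagger_i]=\delta^j_i$ and all other commutators zero, acting on the Fock space generated by applying $Z^\dagger,\lambda^\dagger$ to a vacuum $|0\rangle$ with $Z^i_j|0\rangle=\lambda^i|0\rangle=0$. $t_{m,n}=\mathrm{Tr}\,\mathrm{Sym}(Z^mZ^{\dagger n})$, where Sym is the average over all orderings of the matrix product of $m$ copies of $Z$ and $n$ copies of $Z^\dagger$ (matrix product $(AB)^i_j=\sum_kA^i_kB^k_j$). Physical states are Fock states annihilated by all $\sum_k(Z^i_kZ^{\dagger k}_j-Z^{\dagger i}_kZ^k_j)-N\delta^i_j+\lambda^i\lambda^\dagger_j-(k+1)\delta^i_j$. The ground state is $$|\mathrm{ground}\rangle=\left[\epsilon^{i_1\cdots i_N}(\lambda^\dagger Z^{\dagger0})_{i_1}(\lambda^\dagger Z^{\dagger1})_{i_2}\cdots(\lambda^\dagger Z^{\dagger N-1})_{i_N}\right]^k|0\rangle .$$ The vectors $\prod_{i=1}^N\left(((k+1)N)^{-i/2}\mathrm{Tr}(Z^{\dagger i})\right)^{c_i}|\mathrm{ground}\rangle$, $c_i\ge0$, are linearly independent and span a space $\mathcal H_N$ preserved by all $t_{m,n}$; identify $\mathcal H_N\cong\mathbb C[\tilde p_1,\dots,\tilde p_N]$ by sending this vector to $\prod\tilde p_i^{c_i}$.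 The energy of $\prod\tilde p_i^{c_i}$ (relative to the ground state) is $\sum_iic_i$; $\mathcal H^{(\le E)}_N$ is the span of monomials of energy $\le E$. For $N\ge E$ these spaces are canonically independent of $N$, equal to the space $\mathcal H^{\le E}$ of polynomials in $\tilde p_1,\tilde p_2,\dots$ of weighted degree $\le E$ ($\deg\tilde p_i=i$). $t_{m,n}$ maps $\mathcal H^{(\le E)}_N$ to $\mathcal H^{(\le E+n-m)}_N$. Convergence: operators $A_N$ on $\mathcal H_N$ of energy shift $n-m$, such as $\tilde t_{m,n}$, converge in the large $N$ limit if for every $E>m+n$ the matrix entries (in the monomial bases) of $A_N:\mathcal H^{(\le E)}_N\to\mathcal H^{(\le E+n-m)}_N$, defined for $N$ large on spaces independent of $N$, converge as $N\to\infty$. The limits, compatible for varying $E$, define an operator on $\mathbb C[\tilde p_1,\tilde p_2,\dots]$. The bosonic Fock space representation is the one in which, for $n>0$, $\tilde\alpha_{-n}$ is multiplication by $\tilde p_n$ and $\tilde\alpha_n=\frac n{k+1}\frac\partial{\partial\tilde p_n}$. *)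

(* Defs.v *)
(* Mathematical Components + MathComp-Analysis *)
From HB Require Import structures.
From mathcomp Require Import all_boot all_order all_algebra.
From mathcomp Require mpoly monalg finmap.

Set Implicit Arguments.
Unset Strict Implicit.
Unset Printing Implicit Defensive.

Import Order.TTheory GRing.Theory Num.Theory.
Local Open Scope ring_scope.

(* The notations of mpoly, monalg and MathComp-Analysis are mutually
   incompatible; the modules below delimit the effect of each Import. *)

Module MatrixModel.
Import mpoly.

(* The Fock space is the polynomial ring in the creation operators
   Z^dagger^i_j and lambda^dagger_i, with vacuum |0> = 1; an annihilation
   operator is the partial derivative along its conjugate variable. *)
Definition Fock (C : numClosedFieldType) (N : nat) := {mpoly C[N * N + N]}.

HB.instance Definition _ (C : numClosedFieldType) (N : nat) :=
  GRing.ComAlgebra.on (Fock C N).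

Section MatrixModel.
Variables (C : numClosedFieldType) (N : nat).

Definition Zdag_idx (i j : 'I_N) : 'I_(N * N + N) := lshift N (mxvec_index i j).
Definition lamdag_idx (i : 'I_N) : 'I_(N * N + N) := rshift (N * N) i.

(* Row index = upper index, column index = lower index. *)
Definition Zdag_mx : 'M[Fock C N]_N := \matrix_(i, j) 'X_(Zdag_idx i j).
Definition lamdag_row : 'rV[Fock C N]_N := \row_i 'X_(lamdag_idx i).

Definition Zdag_op (i j : 'I_N) (f : Fock C N) : Fock C N := Zdag_mx i j * f.

(* The indices are transposed because
   [Z^i_j, Zdag^k_l] = delta^i_l delta^k_j. *)
Definition Z_op (i j : 'I_N) (f : Fock C N) : Fock C N :=
  mderiv (Zdag_idx j i) f.

Lemma Z_Zdag_commutator i j k l f :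
  Z_op i j (Zdag_op k l f) - Zdag_op k l (Z_op i j f) =
  ((i == l)%:R * (k == j)%:R) *: f.
Proof.
rewrite /Z_op /Zdag_op mxE mderivM addrK mderivX mnm1E.
have -> : (Zdag_idx k l == Zdag_idx j i) = (k == j) && (i == l).
  rewrite (inj_eq (@lshift_inj _ _)) (inj_eq (@cast_ord_inj _ _ _)).
  by rewrite (inj_eq enum_rank_inj) xpair_eqE [l == i]eq_sym.
case: (k =P j) => [->|_]; last by rewrite /= mulr0 !scale0r mul0r.
case: (i =P l) => [->|_]; last by rewrite /= mul0r !scale0r mul0r.
have -> : (U_(Zdag_idx j l) - U_(Zdag_idx j l))%MM = 0%MM :> 'X_{1..N * N + N}.
  by apply/mnmP => a; rewrite mnmBE mnm0E subnn.
by rewrite mpolyX0 mulr1 !scale1r mul1r.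
Qed.

(* Entry (i, j) of the matrix product of operators encoded by a word in which
   true stands for Z and false for Z^dagger. *)
Fixpoint word_op (w : seq bool) (i j : 'I_N) (f : Fock C N) : Fock C N :=
  if w is b :: w' then
    \sum_(l < N) (if b then Z_op else Zdag_op) i l (word_op w' l j f)
  else if i == j then f else 0.

Definition tr_sym (m n : nat) (f : Fock C N) : Fock C N :=
  ('C(m + n, m)%:R : C)^-1 *:
    \sum_(w : (m + n).-tuple bool | count_mem true w == m)
      \sum_(i < N) word_op w i i f.

(* Contracting with epsilon^{i_1 ... i_N} gives the determinant of the matrix
   whose row r (counted from 0) is lambda^dagger (Z^dagger)^r. *)
Definition ground (k : nat) : Fock C N :=
  (\det (\matrix_(r < N) (lamdag_row *m Zdag_mx ^+ r))) ^+ k.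

Definition sqrt_kN (k : nat) : C := sqrtC (k.+1 * N)%:R.

Definition t_scaled (k m n : nat) (f : Fock C N) : Fock C N :=
  sqrt_kN k ^- (m + n + 2 * (m == n)) *: tr_sym m n f.

Definition scaled_trace (k i : nat) : Fock C N :=
  sqrt_kN k ^- i *: \tr (Zdag_mx ^+ i).

Definition excited (k : nat) (c : nat -> nat) : Fock C N :=
  (\prod_(i < N) scaled_trace k i.+1 ^+ c i) * ground k.

End MatrixModel.
End MatrixModel.
Export MatrixModel.

Module BosonicFock.
Import finmap monalg.

Definition monom := {cmonom nat}.

(* The index i : nat stands for the variable ptilde_{i+1}. *)
Definition bosonic (C : numClosedFieldType) := {malg C[monom]}.

HB.instance Definition _ (C : numClosedFieldType) :=
  GRing.ComAlgebra.on (bosonic C).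

Definition energy (u : monom) : nat := (\sum_(i <- finsupp u) i.+1 * u i)%N.

Section BosonicFock.
Variable C : numClosedFieldType.

Definition coef (w : monom) (P : bosonic C) : C := mcoeff w P.

Definition of_monom (u : monom) : bosonic C := << u >>.

(* Meaningful for n > 0 only. *)
Definition ptilde (n : nat) : bosonic C := of_monom (ucm n.-1).

Definition dptilde (n : nat) (P : bosonic C) : bosonic C :=
  \sum_(u <- msupp P) << mcoeff u P *+ u n.-1 *g divcm u (ucm n.-1) >>.

Definition energy_le (E : nat) : {pred bosonic C} :=
  [pred P : bosonic C | all (fun u => energy u <= E)%N (msupp P)].

(* Inverse of the identification of H_N with C[ptilde_1, ..., ptilde_N]; it is
   only used on polynomials involving no other variables. *)
Definition state (k N : nat) (P : bosonic C) : Fock C N :=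
  \sum_(u <- msupp P) mcoeff u P *: excited C N k u.

End BosonicFock.

Arguments energy_le C E : clear implicits.

End BosonicFock.
Export BosonicFock.

From mathcomp Require Import all_classical all_reals all_analysis complex.
Import numFieldNormedType.Exports.
Local Open Scope classical_set_scope.

Section LargeN.
Variable C : numClosedFieldType.

(* For N >= E, E', B is the map H_N^{(<= E)} -> H_N^{(<= E')} induced by A,
   read on the polynomial spaces; injectivity of state on these spaces is the
   linear independence of the chosen bases and makes B unique there. *)
Definition induces (k N E E' : nat) (A : Fock C N -> Fock C N)
    (B : bosonic C -> bosonic C) : Prop :=
  [/\ {in energy_le C E &, injective (state k N)},
      {in energy_le C E' &, injective (state k N)} &
      {in energy_le C E, forall P,
        B P \in energy_le C E' /\ state k N (B P) = A (state k N P)}].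

(* The family A_N, of energy shift n - m, converges to L in the large N limit. *)
Definition cvg_large_N (k m n : nat) (A : forall N, Fock C N -> Fock C N)
    (L : {linear bosonic C -> bosonic C}) : Prop :=
  forall E, (m + n < E)%N ->
  exists B : nat -> bosonic C -> bosonic C,
    [/\ \forall N \near \oo, induces k E (E + n - m) (@A N) (B N),
        {in energy_le C E, forall P, L P \in energy_le C (E + n - m)} &
        forall u w : monom, (energy u <= E)%N -> (energy w <= E + n - m)%N ->
          coef w (B N (of_monom C u)) @[N --> \oo] --> coef w (L (of_monom C u))].

End LargeN.

(* Main.v *)
(* On a matrix word, the commutator with the Laplacian Delta = Tr Z Z replaces
   the letters Zdag by 2 Z one at a time, so t_{m,n} is, up to a constant, the
   m-th iterated commutator of Delta with the trace p_{m+n} of a power of Zdag.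
   The determinant D with rows lambda Zdag^r satisfies Delta D = 0 and
   (grad D)^2 = 0, and (grad p_l, grad D) is D times a quadratic polynomial in
   the traces.  Hence Delta, conjugated by the ground state D^k, acts on
   polynomials in the traces as an explicit second order operator T_N.  In the
   rescaled variables [T_N, p_L] and [T_N, d/dp_j] are polynomials in 1/N apart
   from a term of order N that is a scalar.  Iterating the commutators, the
   scalars produce Catalan numbers, and the summation formula
   sum_c cat_c binom(x-1-2c, m-c) = binom(x, m) identifies the limit of the
   m-th iterated commutator of p_L with a multiple of the mode L - 2m. *)
Require Import Defs.
From HB Require Import structures.
From mathcomp Require Import all_boot all_order all_algebra.
From mathcomp Require Import zify ring.

Set Implicit Arguments.
Unset Strict Implicit.
Unset Printing Implicit Defensive.

Import Order.TTheory GRing.Theory Num.Theory.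
Local Open Scope ring_scope.

(** * Generalized binomial coefficients and Catalan numbers *)

(** The size of N enters only through [p_0 = N]. Rescaling [p_i] by the power [-i/2] of (k+1)N gives
    [T_N] the prefactor [h N = 1/((k+1)N)], so a product in a commutator survives at large N only
    where a trace has been reduced to a scalar of order N. Such a scalar has energy shift L - 2m =
    0, which singles out L = 2m and the Catalan numbers.

    The obstacle is that neither family closes under commutators: that of [p_L] contains
    derivatives, that of a derivative contains traces times derivatives. Both limits are therefore
    proved by one induction on m. They obey a single law, the coefficient being binom(L, m) for
    [p_L] and binom(-j, m) for the derivative of index j, as if L were -j. For L = m + n this
    coefficient cancels the normalization of Sym, so that only m - n is left.

    The shift from k to k+1 adds the Laplacian of a trace, with weight 1, to its gradient against
    [D^k], with weight k.

    Limits are kept algebraic, as polynomials in [h N], so that linear families compose with no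
    topology on the space of polynomials; coefficients are passed to the limit only at the end. *)

Section StrongRecursion.
Variables (T : Type) (x0 : T) (f : (nat -> T) -> nat -> T).
Hypothesis f_lt : forall g g' m,
  (forall i, (i < m)%N -> g i = g' i) -> f g m = f g' m.

(** Course-of-values recursion by iteration: under [f_lt] the values below [n] are already final
    after [n] rounds, whence [m.+1] rounds for the value at [m]. *)
Definition strong_rec m := iter m.+1 f (fun=> x0) m.

Lemma strong_recE m : strong_rec m = f strong_rec m.
Proof.
have stable n n' i : (i < n)%N -> (i < n')%N ->
    iter n f (fun=> x0) i = iter n' f (fun=> x0) i.
  elim: n n' i => // n IHn [//|n'] i lt_in lt_in'; apply: f_lt => j lt_ji.
  by apply: IHn; exact: leq_trans lt_ji _.
by rewrite {1}/strong_rec iterS; apply: f_lt => i lt_im; exact: stable.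
Qed.

End StrongRecursion.

Lemma sum_triangle (V : nmodType) (F : nat -> nat -> V) m :
  \sum_(c < m) \sum_(a < c.+1) F a (c - a)%N =
  \sum_(a < m) \sum_(b < m - a) F a b.
Proof.
elim: m => [|m IHm]; first by rewrite !big_ord0.
rewrite big_ord_recr /= {}IHm [RHS]big_ord_recr /= subSnn big_ord1.
rewrite [X in _ + X]big_ord_recr /= subnn addrA -big_split /=.
congr (_ + _); apply: eq_bigr => a _.
by rewrite subSn 1?ltnW // [RHS]big_ord_recr.
Qed.

(* Catalan numbers, through Segner's recurrence. *)
HB.lock Definition cat (C : numFieldType) := strong_rec (0 : C) (fun g m =>
  if m is m'.+1 then \sum_(c < m) g c * g (m' - c)%N else 1).

Section GeneralizedBinomials.
Variable C : numFieldType.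
Implicit Types x : C.
Local Notation cat := (cat C).

(** The binomial coefficient x(x-1)...(x-m+1)/m! with x in the field; negative integers x occur in
    the limits of the derivatives. *)
Fixpoint gbin x m := if m is m'.+1 then x / m%:R * gbin (x - 1) m' else 1.

Lemma gbinS x m : gbin x m.+1 = x / m.+1%:R * gbin (x - 1) m.
Proof. by []. Qed.

Lemma gbin_pascal x m : gbin x m.+1 = gbin (x - 1) m.+1 + gbin (x - 1) m.
Proof.
elim: m x => [|m IHm] x; first by rewrite /= !divr1; ring.
rewrite gbinS (gbinS (x - 1) m.+1).
have ->: gbin (x - 1 - 1) m.+1 = gbin (x - 1) m.+1 - gbin (x - 1 - 1) m.
  by rewrite [gbin (x - 1) m.+1]IHm addrK.
rewrite mulrBr (gbinS (x - 1) m); set u := gbin _ m; clearbody u.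
rewrite -(natr1 m.+1) -(natr1 m); field.
by rewrite !natr1 !pnatr_eq0.
Qed.

Lemma gbin_nat n m : gbin n%:R m = 'C(n, m)%:R.
Proof.
elim: m n => [|m IHm] [|n]; rewrite ?bin0 // gbinS ?mul0r //.
have m1_neq0 : m.+1%:R != 0 :> C by rewrite pnatr_eq0.
have -> : n.+1%:R - 1 = n%:R :> C by rewrite -natr1 addrK.
apply: (mulfI m1_neq0); rewrite IHm -natrM -mul_bin_diag natrM mulrA.
by rewrite [m.+1%:R * _]mulrC divfK.
Qed.

Let catE m : cat m = if m is m'.+1 then \sum_(c < m) cat c * cat (m' - c)%N
                     else 1.
Proof.
rewrite cat.unlock strong_recE //= => g g' [//|n] eq_gg'.
by apply: eq_bigr => i _; rewrite !eq_gg' // ltnS leq_subr.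
Qed.

Lemma cat0 : cat 0 = 1. Proof. by rewrite catE. Qed.

Lemma catS m : cat m.+1 = \sum_(c < m.+1) cat c * cat (m - c)%N.
Proof. by rewrite catE. Qed.

(* The generating function of Catalan numbers at t / (1 + t)^2 is 1 + t. *)
Lemma sum_cat_gbin x m :
  \sum_(c < m.+1) cat c * gbin (x - 1 - c.*2%:R) (m - c) = gbin x m.
Proof.
elim/ltn_ind: m x => -[|m] IHm x; first by rewrite big_ord1 cat0 mulr1.
rewrite big_ord_recl cat0 mul1r subr0 gbin_pascal; congr (_ + _).
(* Segner's recurrence makes [cat c.+1] a convolution. After [sum_triangle] the inner sum is the
   formula at [m - a], and the outer one is the formula at [m] for [x - 1]. *)
rewrite -(IHm m) //.
transitivity (\sum_(c < m.+1) \sum_(a < c.+1) cat a *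
    (cat (c - a)%N * gbin (x - 1 - 1 - a.*2%:R - 1 - (c - a).*2%:R)
       (m - a - (c - a)))).
  apply: eq_bigr => c _; rewrite /bump /= catS subSS mulr_suml.
  apply: eq_bigr => a _; rewrite mulrA.
  have le_ac : (a <= c)%N by rewrite -ltnS.
  congr (_ * gbin _ _); last by rewrite -subnDA subnKC.
  have -> : (1 + c).*2 = (2 + a.*2 + (c - a).*2)%N by lia.
  by rewrite !natrD; ring.
rewrite (sum_triangle (fun a b => cat a * (cat b *
  gbin (x - 1 - 1 - a.*2%:R - 1 - b.*2%:R) (m - a - b)))).
apply: eq_bigr => a _; rewrite -mulr_sumr subSn 1?IHm //; last by rewrite -ltnS.
by rewrite ltnS leq_subr.
Qed.

End GeneralizedBinomials.

(** * Perturbative limits *)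

Section PerturbationLimits.
Variables (C : numFieldType) (V : lmodType C) (h : nat -> C).

(* The sequences that are polynomials in h N with coefficients in V for N > 0,
   together with their constant terms, the limits for h N tending to 0. *)
Inductive tends : (nat -> V) -> V -> Prop :=
| tends_cst v : tends (fun=> v) v
| tends_small x l : tends x l -> tends (fun N => h N *: x N) 0
| tendsD x y l l' :
    tends x l -> tends y l' -> tends (fun N => x N + y N) (l + l')
| tends_ext x y l :
    (forall N, (0 < N)%N -> x N = y N) -> tends x l -> tends y l.

Lemma tends_sum (I : Type) (r : seq I) (P : pred I) (x : I -> nat -> V) l :
  (forall i, P i -> tends (x i) (l i)) ->
  tends (fun N => \sum_(i <- r | P i) x i N) (\sum_(i <- r | P i) l i).
Proof.
move=> tends_xl; elim: r => [|i r IHr].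
  by rewrite big_nil; apply: tends_ext (tends_cst 0) => N _; rewrite big_nil.
rewrite big_cons; case: ifP => Pi.
  apply: tends_ext (tendsD (tends_xl i Pi) IHr) => N _.
  by rewrite big_cons Pi.
by apply: tends_ext IHr => N _; rewrite big_cons Pi.
Qed.

Definition tends_op (A : nat -> V -> V) (L : V -> V) :=
  [/\ forall N, linear (A N), linear L & forall v, tends (A^~ v) (L v)].

(** Linearity suffices, without any uniformity: by induction on the derivation of [tends], the
    factors [h N] pass through [A N] until only constant vectors remain. *)
Lemma tends_opP A L x l : tends_op A L -> tends x l ->
  tends (fun N => A N (x N)) (L l).
Proof.
move=> [linA linL tendsA].
have L0 : L 0 = 0 by have := linL (-1) 0 0; rewrite !scaleN1r !addNr.
have A0 N : A N 0 = 0 by have := linA N (-1) 0 0; rewrite !scaleN1r !addNr.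
elim=> {x l} [v|x l _ IHx|x y l l' _ IHx _ IHy|x y l eq_xy _ IHx].
- exact: tendsA.
- rewrite L0; apply: tends_ext (tends_small IHx) => N _.
  by rewrite -[h N *: x N]addr0 linA A0 addr0.
- rewrite -[l]scale1r linL scale1r; apply: tends_ext (tendsD IHx IHy) => N _.
  by rewrite -{2}[x N]scale1r linA scale1r.
- by apply: tends_ext IHx => N N_gt0; rewrite eq_xy.
Qed.

Lemma tendsZ a x l : tends x l -> tends (fun N => a *: x N) (a *: l).
Proof.
have linZ : linear ( *:%R a : V -> V).
  by move=> c u v; rewrite scalerDr !scalerA mulrC.
apply: (@tends_opP (fun _ v => a *: v) ( *:%R a)); split=> // v.
exact: tends_cst.
Qed.

Lemma tends_smallZ x l a : tends x l -> tends (fun N => (h N * a) *: x N) 0.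
Proof.
move=> /(tendsZ a)/tends_small; apply: tends_ext => N _.
by rewrite scalerA.
Qed.

End PerturbationLimits.

Arguments tends_ext {C V h x y l}.

(** * Iterated commutators as divided powers *)

Definition ad (C : numFieldType) (V : lmodType C) (T A : V -> V) P :=
  T (A P) - A (T P).

(* The divided power ad(T / 2)^m / m!, for which Leibniz's rule has no
   binomial coefficients. *)
HB.lock Definition dpow (C : numFieldType) (V : lmodType C) (T : V -> V) m A P
  : V := (2 ^+ m * m`!%:R : C)^-1 *: iter m (ad T) A P.

Section DividedAdjointPowers.
Variables (C : numFieldType) (V : lmodType C) (T : V -> V).
Hypothesis T_linear : linear T.
Implicit Types (A B : V -> V) (S : V -> Prop).

Let T_B : {morph T : u v / u - v}.
Proof.
by move=> u v; rewrite addrC -scaleN1r T_linear scaleN1r addrC.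
Qed.

Let T_0 : T 0 = 0. Proof. by have := T_B 0 0; rewrite !subrr. Qed.

Let T_D : {morph T : u v / u + v}.
Proof. by move=> u v; rewrite -{1}[u]scale1r T_linear scale1r. Qed.

Let T_Z a : {morph T : u / a *: u}.
Proof. by move=> u; rewrite -{1}[a *: u]addr0 T_linear T_0 addr0. Qed.

Local Notation ad := (ad T).
Local Notation dpow := (dpow T).

Lemma dpow0 A P : dpow 0 A P = A P.
Proof. by rewrite dpow.unlock mulr1 invr1 scale1r. Qed.

Lemma ad_linear A : linear A -> linear (ad A).
Proof.
move=> linA a u v; rewrite /ad !(T_linear, linA) opprD scalerBr.
by rewrite addrACA.
Qed.

Lemma dpow_linear m A : linear A -> linear (dpow m A).
Proof.
move=> linA; have linI : linear (iter m ad A).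
  by elim: m => // m IHm; exact: ad_linear.
by move=> a u v; rewrite dpow.unlock linI scalerDr !scalerA mulrC.
Qed.

Lemma dpowS m A P : dpow m.+1 A P = (2 * m.+1%:R)^-1 *: ad (dpow m A) P.
Proof.
rewrite /ad dpow.unlock T_Z -scalerBr scalerA -invfM iterS factS exprS natrM.
congr (_^-1 *: _); ring.
Qed.

(** Serves to iterate commutator formulas whose finite sums are valid only below an energy bound
    [S], which [T] preserves. *)
Lemma dpow_in_ext S m A B : (forall P, S P -> S (T P)) ->
  (forall P, S P -> A P = B P) -> forall P, S P -> dpow m A P = dpow m B P.
Proof.
move=> stabS eqAB; rewrite dpow.unlock => P SP; congr (_ *: _).
elim: m P SP => [|m IHm] P SP //=; first exact: eqAB.
by rewrite /ad !IHm //; exact: stabS.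
Qed.

Lemma dpow_ext m A B : A =1 B -> dpow m A =1 dpow m B.
Proof. by move=> eqAB P; apply: (@dpow_in_ext (fun=> True)). Qed.

Lemma dpowSr m A P : dpow m.+1 A P = (2 * m.+1%:R)^-1 *: dpow m (ad A) P.
Proof.
rewrite dpow.unlock scalerA -invfM iterSr factS exprS natrM.
congr (_^-1 *: _); ring.
Qed.

Lemma dpowZ m a A P : dpow m (fun Q => a *: A Q) P = a *: dpow m A P.
Proof.
elim: m P => [|m IHm] P; first by rewrite !dpow0.
by rewrite !dpowS /ad !IHm T_Z -scalerBr !scalerA mulrC.
Qed.

Lemma dpowD m A B P :
  dpow m (fun Q => A Q + B Q) P = dpow m A P + dpow m B P.
Proof.
elim: m P => [|m IHm] P; first by rewrite !dpow0.
by rewrite !dpowS /ad !IHm T_D opprD addrACA scalerDr.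
Qed.

Lemma dpow_zero m P : dpow m (fun=> 0) P = 0.
Proof.
elim: m P => [|m IHm] P; first by rewrite !dpow0.
by rewrite !dpowS /ad !IHm T_0 subrr scaler0.
Qed.

Lemma dpow_sum m (I : Type) (r : seq I) (A : I -> V -> V) P :
  dpow m (fun Q => \sum_(i <- r) A i Q) P = \sum_(i <- r) dpow m (A i) P.
Proof.
elim: r => [|i r IHr].
  rewrite big_nil -[RHS](dpow_zero m P); apply: dpow_ext => Q.
  by rewrite big_nil.
by rewrite big_cons -IHr -dpowD; apply: dpow_ext => Q; rewrite big_cons.
Qed.

Lemma dpow_comp m A B P : linear A ->
  dpow m (fun Q => A (B Q)) P = \sum_(c < m.+1) dpow c A (dpow (m - c) B P).
Proof.
move=> linA; elim: m P => [|m IHm] P.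
  by rewrite big_ord1 !dpow0.
have m1_neq0 : m.+1%:R != 0 :> C by rewrite pnatr_eq0.
have adE n D Q : ad (dpow n D) Q = (2 * n.+1%:R) *: dpow n.+1 D Q.
  by rewrite dpowS scalerA mulfV ?scale1r // mulf_neq0 ?pnatr_eq0.
rewrite dpowS /ad !IHm (big_morph T T_D T_0) -sumrB.
have step (c : 'I_m.+1) :
    T (dpow c A (dpow (m - c) B P)) - dpow c A (dpow (m - c) B (T P)) =
    (2 * c.+1%:R) *: dpow c.+1 A (dpow (m - c) B P) +
    (2 * (m.+1 - c)%:R) *: dpow c A (dpow (m.+1 - c) B P).
  have linc := dpow_linear c linA.
  rewrite subSn -1?ltnS // -adE /ad.
  have -> : dpow c A (T (dpow (m - c) B P)) =
      dpow c A (dpow (m - c) B (T P)) + (2 * (m - c).+1%:R) *: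
      dpow c A (dpow (m - c).+1 B P).
    rewrite addrC -linc; congr (dpow c A _).
    by rewrite -adE /ad subrK.
  by rewrite opprD addrA subrK.
(* After a shift of the first sum both run over [c <= m.+1], the added end terms having weight zero.
   The weights [2 c] and [2 (m.+1 - c)] then add up to the constant [2 m.+1]. *)
rewrite (eq_bigr _ (fun c _ => step c)) big_split /= scalerDr.
have -> : \sum_(c < m.+1) (2 * c.+1%:R) *: dpow c.+1 A (dpow (m - c) B P) =
    \sum_(c < m.+2) (2 * c%:R) *: dpow c A (dpow (m.+1 - c) B P).
  by rewrite [RHS]big_ord_recl mulr0 scale0r add0r.
have -> : \sum_(c < m.+1) (2 * (m.+1 - c)%:R) *: dpow c A (dpow (m.+1 - c) B P)
    = \sum_(c < m.+2) (2 * (m.+1 - c)%:R) *: dpow c A (dpow (m.+1 - c) B P).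
  by rewrite [RHS]big_ord_recr /= subnn mulr0 scale0r addr0.
rewrite -scalerDr -big_split /= scaler_sumr; apply: eq_bigr => c _.
rewrite -scalerDl scalerA -mulrDr -natrD subnKC -1?ltnS //.
by rewrite mulVf ?scale1r // mulf_neq0 ?pnatr_eq0.
Qed.

End DividedAdjointPowers.

(** * Large N limits of the iterated commutators *)

Section CollectiveModes.
Variables (C : numFieldType) (V : lmodType C) (k : nat) (h : nat -> C).
Variables (F : nat -> V -> Prop) (T : nat -> V -> V) (pt b : nat -> V -> V).

Local Notation kappa := (k.+1%:R : C).
Local Notation cat := (cat C).

(* Multiplication by the trace of the i-th power: the trace of 1 is N. *)
Definition trmul (N i : nat) := if i is 0 then *:%R N%:R else pt i.

(** A positive index raises the energy, opposite to the convention for the current algebra; [Negz n]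
    is the index -(n+1). *)
Definition mode (n : int) : V -> V :=
  match n with
  | Posz 0 => fun=> 0
  | Posz n => pt n
  | Negz n => fun P => kappa^-1 *: b n.+1 P
  end.

(** The coefficient of N in the m-th divided commutator of [p_L]: a scalar preserves the energy,
    which forces L = 2m. *)
Definition lead (L m : nat) : C := (L == m.*2)%:R * cat m.

(* The diverging part of order N is removed. *)
Definition trmul_rem (N L m : nat) P :=
  dpow (T N) m (trmul N L) P - (N%:R * lead L m) *: P.

(* For L = 2 m the limit of trmul_rem is this scalar, of which only the
   existence matters in the end: it is multiplied by h N. *)
Definition subleading := strong_rec (0 : C) (fun g m =>
  if m is m'.+1 then
    2 * (\sum_(c < m) cat c * g (m' - c)%N)
    - k%:R / kappa * (m'.*2.+1)%:R * cat m'
  else 0).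

Let subleadingE m : subleading m = if m is m'.+1 then
    2 * (\sum_(c < m) cat c * subleading (m' - c)%N)
    - k%:R / kappa * (m'.*2.+1)%:R * cat m'
  else 0.
Proof.
rewrite /subleading strong_recE //= => g g' [//|n] eq_gg'.
congr (2 * _ - _).
by apply: eq_bigr => i _; rewrite !eq_gg' // ltnS leq_subr.
Qed.

Definition trmul_lim (L m : nat) P :=
  gbin L%:R m *: mode (L%:Z - m.*2%:Z) P
  + ((L == m.*2)%:R * subleading m) *: P.

(** For i > 0 the operator [kappa *: mode (- i)] is [b i]; the coefficient is that of [trmul_lim]
    with L replaced by -j. *)
Definition b_lim (j m : nat) P :=
  gbin (- j%:R) m *: (kappa *: mode (- (j + m.*2)%:Z) P).

Hypothesis hE : forall N, (0 < N)%N -> h N * (kappa * N%:R) = 1.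
Hypothesis F_T : forall E N P, F E P -> F E (T N P).
Hypothesis F_exhaustive : forall P n, exists2 E, (n <= E)%N & F E P.
Hypothesis T_linear : forall N, linear (T N).
Hypothesis pt_linear : forall i, linear (pt i).
Hypothesis b_linear : forall i, linear (b i).
Hypothesis T_trmul : forall N L E P, F E P ->
  ad (T N) (trmul N L) P = (h N * L%:R) *:
    (kappa *: (\sum_(a < L.-1) trmul N a (trmul N (L - 2 - a) P))
     - (k * L.-1)%:R *: trmul N (L - 2) P
     + 2 *: (\sum_(j < E) trmul N (L + j).-1 (b j.+1 P))).
Hypothesis T_b : forall N j E P, F E P ->
  ad (T N) (b j) P = - (h N * j%:R) *:
    ((2 * kappa) *: (\sum_(l < E) trmul N l (b (j + 2 + l) P))
     - (k * j.+1)%:R *: b (j + 2) P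
     + \sum_(i < j.+1) b i.+1 (b (j.+1 - i) P)).

Let kappa_neq0 : kappa != 0. Proof. by rewrite pnatr_eq0. Qed.

Lemma trmul_linear N i : linear (trmul N i).
Proof.
by case: i => //= a u v; rewrite scalerDr !scalerA mulrC.
Qed.

Lemma mode_linear n : linear (mode n).
Proof.
case: n => [[|n]|n] //= a u v; first by rewrite scaler0 addr0.
by rewrite b_linear scalerDr !scalerA mulrC.
Qed.

Lemma trmul_lim_linear L m : linear (trmul_lim L m).
Proof.
move=> a u v; rewrite /trmul_lim mode_linear !scalerDr !scalerA.
by rewrite ![a * _]mulrC addrACA.
Qed.

Lemma b_lim_linear j m : linear (b_lim j m).
Proof.
move=> a u v; rewrite /b_lim mode_linear !scalerDr !scalerA.
by congr (_ *: _ + _); ring.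
Qed.

Lemma trmul_rem_linear N L m : linear (trmul_rem N L m).
Proof.
move=> a u v; rewrite /trmul_rem.
rewrite (dpow_linear (@T_linear N) _ (@trmul_linear N L)).
rewrite scalerDr opprD addrACA scalerBr (scalerA _ a) (scalerA a).
by rewrite [a * _]mulrC.
Qed.

Lemma dpow_trmulS N L m E P : F E P ->
  dpow (T N) m.+1 (trmul N L) P = (h N * L%:R / (2 * m.+1%:R)) *:
    (kappa *: (\sum_(a < L.-1) \sum_(c < m.+1)
       dpow (T N) c (trmul N a) (dpow (T N) (m - c) (trmul N (L - 2 - a)) P))
     - (k * L.-1)%:R *: dpow (T N) m (trmul N (L - 2)) P
     + 2 *: (\sum_(j < E) \sum_(c < m.+1)
       dpow (T N) c (trmul N (L + j).-1) (dpow (T N) (m - c) (b j.+1) P))).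
Proof.
move=> FP; rewrite dpowSr //.
rewrite (dpow_in_ext (S := F E) m _ (fun Q => @T_trmul N L E Q)) //; last first.
  by move=> Q; exact: F_T.
rewrite dpowZ // scalerA; congr (_ *: _); first by rewrite mulrC.
rewrite !dpowD //; congr (_ + _ + _).
- rewrite dpowZ // dpow_sum //; congr (_ *: _); apply: eq_bigr => a _.
  by rewrite dpow_comp //; exact: trmul_linear.
- rewrite -scaleNr -dpowZ //; apply: dpow_ext => Q.
  by rewrite scaleNr.
- rewrite dpowZ // dpow_sum //; congr (_ *: _); apply: eq_bigr => a _.
  by rewrite dpow_comp //; exact: trmul_linear.
Qed.

Lemma dpow_bS N j m E P : F E P ->
  dpow (T N) m.+1 (b j) P = (- (h N * j%:R) / (2 * m.+1%:R)) *:
    ((2 * kappa) *: (\sum_(l < E) \sum_(c < m.+1)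
       dpow (T N) c (trmul N l) (dpow (T N) (m - c) (b (j + 2 + l)) P))
     - (k * j.+1)%:R *: dpow (T N) m (b (j + 2)) P
     + \sum_(i < j.+1) \sum_(c < m.+1)
         dpow (T N) c (b i.+1) (dpow (T N) (m - c) (b (j.+1 - i)) P)).
Proof.
move=> FP; rewrite dpowSr //.
rewrite (dpow_in_ext (S := F E) m _ (fun Q => @T_b N j E Q)) //; last first.
  by move=> Q; exact: F_T.
rewrite dpowZ // scalerA; congr (_ *: _); first by rewrite mulrC.
rewrite !dpowD //; congr (_ + _ + _).
- rewrite dpowZ // dpow_sum //; congr (_ *: _); apply: eq_bigr => a _.
  by rewrite dpow_comp //; exact: trmul_linear.
- rewrite -scaleNr -dpowZ //; apply: dpow_ext => Q.
  by rewrite scaleNr.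
- rewrite dpow_sum //; apply: eq_bigr => a _.
  by rewrite dpow_comp.
Qed.

(** For each [c] only [a = c.*2] contributes, which leaves Segner's recurrence; the prefactor is 1
    at L = 2(m+1), the only case with nonzero terms. *)
Lemma leadS L m : lead L m.+1 = L%:R / (2 * m.+1%:R) *
  \sum_(a < L.-1) \sum_(c < m.+1) lead a c * lead (L - 2 - a) (m - c).
Proof.
rewrite exchange_big /=.
have diag (c : 'I_m.+1) :
    \sum_(a < L.-1) lead a c * lead (L - 2 - a) (m - c) =
    (L == m.+1.*2)%:R * (cat c * cat (m - c)%N).
  have [lt_cL|le_Lc] := ltnP c.*2 L.-1; last first.
    have /negPf-> : L != m.+1.*2 by case: c le_Lc => c /= le_cm; lia.
    rewrite mul0r big1 // => a _; rewrite /lead.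
    by have /negPf-> : val a != c.*2; [case: a => a /=; lia | rewrite !mul0r].
  rewrite (bigD1 (Ordinal lt_cL)) //= big1 => [|a ne_a]; last first.
    rewrite /lead; suff /negPf-> : val a != c.*2 by rewrite !mul0r.
    by apply: contra ne_a => /eqP eq_a; apply/eqP/val_inj.
  rewrite /lead eqxx mul1r addr0.
  have -> : (L - 2 - c.*2 == (m - c).*2)%N = (L == m.+1.*2).
    by case: c lt_cL => c /= le_cm; lia.
  by rewrite mulrCA.
rewrite (eq_bigr _ (fun c _ => diag c)) -mulr_sumr -catS /lead.
case: eqP => [->|_]; last by rewrite !mul0r mulr0.
by rewrite -mul2n natrM divff ?mul1r // mulf_neq0 ?pnatr_eq0.
Qed.

(** With weight [h N * kappa] a trace factor becomes a scalar: its remainder is suppressed by [h N],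
    and its order N part is normalized by [hE]. *)
Lemma tends_trmul L m x l :
    tends_op h (fun N => trmul_rem N L m) (trmul_lim L m) -> tends h x l ->
  tends h (fun N => (h N * kappa) *: dpow (T N) m (trmul N L) (x N))
    (lead L m *: l).
Proof.
move=> tendsL tends_x; rewrite -[_ *: l]add0r.
have lim1 := tends_smallZ kappa (tends_opP tendsL tends_x).
apply: tends_ext (tendsD lim1 (tendsZ (lead L m) tends_x)) => N N_gt0.
rewrite scalerBr (scalerA (h N * kappa)).
have -> : h N * kappa * (N%:R * lead L m) = lead L m.
  by rewrite mulrA -[h N * _ * _]mulrA hE // mul1r.
by rewrite subrK.
Qed.

(** For scalars a, a' and remainders r, r', the product (N a + r)(N a' + r') times [h N * kappa] is
    N a a' + a r' + a' r up to a term of order [h N]. *)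
Lemma tends_trmul2 L m L' m' P :
    tends_op h (fun N => trmul_rem N L m) (trmul_lim L m) ->
    tends_op h (fun N => trmul_rem N L' m') (trmul_lim L' m') ->
  tends h (fun N => (h N * kappa) *: dpow (T N) m (trmul N L)
      (dpow (T N) m' (trmul N L') P) - (N%:R * (lead L m * lead L' m')) *: P)
    (lead L m *: trmul_lim L' m' P + lead L' m' *: trmul_lim L m P).
Proof.
move=> tendsL tendsL'; have [_ _ /(_ P) tendsP] := tendsL.
have [_ _ /(_ P) tendsP'] := tendsL'.
apply: tends_ext (tendsD (tends_trmul tendsL tendsP') (tendsZ _ tendsP)).
move=> N N_gt0; have linL := dpow_linear (@T_linear N) m (@trmul_linear N L).
have -> : trmul_rem N L' m' P =
    (- (N%:R * lead L' m')) *: P + dpow (T N) m' (trmul N L') P.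
  by rewrite /trmul_rem scaleNr addrC.
rewrite linL scalerDr (scalerA (h N * kappa)).
have -> : h N * kappa * - (N%:R * lead L' m') = - lead L' m'.
  by rewrite mulrN mulrA -[h N * _ * _]mulrA hE // mul1r.
rewrite /trmul_rem scalerBr scaleNr addrC addrACA subrr add0r addrC.
by rewrite scalerA; congr (_ - _ *: _); ring.
Qed.

Section Step.
Variables (m : nat).
Hypothesis IHp : forall c L, (c <= m)%N ->
  tends_op h (fun N => trmul_rem N L c) (trmul_lim L c).
Hypothesis IHb : forall c j, (c <= m)%N -> (0 < j)%N ->
  tends_op h (fun N => dpow (T N) c (b j)) (b_lim j c).

Let tends_b c j P : (c <= m)%N -> (0 < j)%N ->
  tends h (fun N => dpow (T N) c (b j) P) (b_lim j c P).
Proof. by move=> le_cm j_gt0; case: (IHb le_cm j_gt0) => _ _; apply. Qed.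

Let sum_lead L n (f : nat -> V) c :
  \sum_(a < n) lead (L + a) c *: f a =
  if (L <= c.*2 < L + n)%N then cat c *: f (c.*2 - L)%N else 0.
Proof.
case: ifP => [/andP[le_Lc lt_cn]|out_c].
  have lt_n : (c.*2 - L < n)%N by lia.
  rewrite (bigD1 (Ordinal lt_n)) //= big1 => [|a ne_a]; last first.
    rewrite /lead; suff /negPf-> : (L + a)%N != c.*2 by rewrite mul0r scale0r.
    by apply: contra ne_a => /eqP eq_a; apply/eqP/val_inj => /=; lia.
  by rewrite addr0 /lead subnKC // eqxx mul1r.
apply: big1 => a _; rewrite /lead.
suff /negPf-> : (L + a)%N != c.*2 by rewrite mul0r scale0r.
by case: a => a /= lt_an; lia.
Qed.

Lemma dpow_b_step j : (0 < j)%N ->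
  tends_op h (fun N => dpow (T N) m.+1 (b j)) (b_lim j m.+1).
Proof.
move=> j_gt0; split=> [N||P]; first exact: dpow_linear.
  exact: b_lim_linear.
(* The traces that leave a scalar in the limit have index [c.*2] with [c <= m]; the cutoff [E] has
   to exceed all of these. *)
have [E le_mE FP] := F_exhaustive P m.*2.+1.
have j2_gt0 l : (0 < j + 2 + l)%N by rewrite addn2.
have lim1 : tends h (fun N => \sum_(l < E) \sum_(c < m.+1)
     (h N * kappa) *: dpow (T N) c (trmul N l)
      (dpow (T N) (m - c) (b (j + 2 + l)) P))
    (\sum_(l < E) \sum_(c < m.+1) lead l c *: b_lim (j + 2 + l) (m - c) P).
  apply: tends_sum => l _; apply: tends_sum => c _.
  apply: tends_trmul; first by apply: IHp; rewrite -ltnS.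
  by apply: tends_b => //; exact: leq_subr.
have lim2 : tends h (fun N => dpow (T N) m (b (j + 2)) P) (b_lim (j + 2) m P).
  by apply: tends_b => //; rewrite addn2.
have lim3 : tends h (fun N => \sum_(i < j.+1) \sum_(c < m.+1)
     dpow (T N) c (b i.+1) (dpow (T N) (m - c) (b (j.+1 - i)) P))
    (\sum_(i < j.+1) \sum_(c < m.+1)
       b_lim i.+1 c (b_lim (j.+1 - i) (m - c) P)).
  apply: tends_sum => i _; apply: tends_sum => c _.
  have le_cm : (c <= m)%N by rewrite -ltnS.
  apply: (tends_opP (IHb le_cm (ltn0Sn i))).
  by apply: tends_b; rewrite ?leq_subr ?subn_gt0.
have := tendsZ (- j%:R / (2 * m.+1%:R)) (tendsD (tendsZ 2 lim1)
  (tendsD (tends_smallZ (- (k * j.+1)%:R) lim2) (tends_small lim3))).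
have <- : b_lim j m.+1 P = (- j%:R / (2 * m.+1%:R)) *: (2 *: (\sum_(l < E)
    \sum_(c < m.+1) lead l c *: b_lim (j + 2 + l) (m - c) P) + (0 + 0)).
  rewrite !addr0 exchange_big /= scalerA.
  transitivity ((- j%:R / m.+1%:R) *: (\sum_(c < m.+1) cat c *:
      b_lim (j + 2 + c.*2) (m - c) P)); last first.
    congr (_ *: _).
      by field; rewrite -?natrS ?nat1r ?natr1 pnatr_eq0.
    apply: eq_bigr => c _; have := sum_lead 0 E
      (fun l => b_lim (j + 2 + l) (m - c) P) c.
    have lt_cE : (c.*2 < E)%N by case: c => c /= le_cm; lia.
    by rewrite add0n lt_cE subn0.
  (* The remaining sum is [sum_cat_gbin] at x = -j - 1. *)
  rewrite /b_lim gbinS -scalerA; congr (_ *: _).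
  rewrite -(sum_cat_gbin _ m) scaler_suml; apply: eq_bigr => c _.
  have le_cm : (c <= m)%N by rewrite -ltnS.
  rewrite -scalerA; congr (_ *: (gbin _ _ *: (_ *: mode (- _%:Z) _))).
    by rewrite !natrD; ring.
  by rewrite -!addnA; congr (_ + _)%N; lia.
apply: tends_ext => N _; rewrite (dpow_bS _ _ _ FP).
have -> : - (h N * j%:R) / (2 * m.+1%:R) = (- j%:R / (2 * m.+1%:R)) * h N.
  by ring.
rewrite -[RHS]scalerA; congr (_ *: _).
rewrite !scalerDr scalerN -!addrA; congr (_ + (_ + _)).
- rewrite [RHS]scalerA mulrCA -scalerA; congr (2 *: _); rewrite scaler_sumr.
  by apply: eq_bigr => l _; rewrite scaler_sumr.
- by rewrite mulrN scaleNr scalerA.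
Qed.

Lemma dpow_trmul_step L :
  tends_op h (fun N => trmul_rem N L m.+1) (trmul_lim L m.+1).
Proof.
split=> [N||P]; [exact: trmul_rem_linear|exact: trmul_lim_linear|].
have [E le_mE FP] := F_exhaustive P m.*2.+2.
have lim1 : tends h (fun N => \sum_(a < L.-1) \sum_(c < m.+1)
    ((h N * kappa) *: dpow (T N) c (trmul N a)
        (dpow (T N) (m - c) (trmul N (L - 2 - a)) P)
     - (N%:R * (lead a c * lead (L - 2 - a) (m - c))) *: P))
    (\sum_(a < L.-1) \sum_(c < m.+1)
      (lead a c *: trmul_lim (L - 2 - a) (m - c) P
       + lead (L - 2 - a) (m - c) *: trmul_lim a c P)).
  apply: tends_sum => a _; apply: tends_sum => c _.
  by apply: tends_trmul2; apply: IHp; rewrite ?leq_subr // -ltnS.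
have lim2 := tends_trmul (IHp (L - 2) (leqnn m)) (tends_cst h P).
have lim3 : tends h (fun N => \sum_(j < E) \sum_(c < m.+1) (h N * kappa) *:
       dpow (T N) c (trmul N (L + j).-1) (dpow (T N) (m - c) (b j.+1) P))
    (\sum_(j < E) \sum_(c < m.+1) lead (L + j).-1 c *: b_lim j.+1 (m - c) P).
  apply: tends_sum => j _; apply: tends_sum => c _.
  apply: tends_trmul; first by apply: IHp; rewrite -ltnS.
  by apply: tends_b => //; exact: leq_subr.
have := tendsZ (L%:R / (2 * m.+1%:R)) (tendsD lim1
  (tendsD (tendsZ (- (k * L.-1)%:R / kappa) lim2) (tendsZ (2 / kappa) lim3))).
set l := _ *: _; have <- : trmul_lim L m.+1 P = l; last first.
  apply: tends_ext => N N_gt0; rewrite /trmul_rem (dpow_trmulS _ _ _ FP).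
  rewrite leadS.
  under eq_bigr => a _ do rewrite sumrB -scaler_sumr -scaler_suml -mulr_sumr.
  rewrite sumrB -scaler_sumr -scaler_suml -mulr_sumr.
  under [X in (2 / kappa) *: X]eq_bigr => j _ do rewrite -scaler_sumr.
  rewrite -scaler_sumr.
  have -> : h N * L%:R / (2 * m.+1%:R) = L%:R / (2 * m.+1%:R) * h N by ring.
  rewrite -(scalerA _ (h N)) [N%:R * (_ * _)]mulrCA -(scalerA _ (N%:R * _)).
  rewrite -scalerBr; congr (_ *: _).
  rewrite addrAC; congr (_ - _); rewrite !scalerDr -!addrA scalerN.
  congr (_ + (_ + _)); rewrite !scalerA //.
    rewrite -scaleNr; congr (_ *: _).
    by field; rewrite nat1r pnatr_eq0.
  congr (_ *: _).
  by field; rewrite nat1r pnatr_eq0.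
rewrite {}/l; case: L {lim1 lim2 lim3} => [|L].
  have zero : 0%:R = 0 :> C by [].
  by rewrite /trmul_lim gbinS zero !mul0r !scale0r addr0.
rewrite [L.+1.-1]/= subSS.
have factor (x g e s : C) (M Q Y Z : V) :
    g *: M + (e * s) *: Q = Y + kappa^-1 *: Z ->
    (x * g) *: M + (e * (x * s)) *: Q = x *: Y + kappa^-1 *: (x *: Z).
  move=> eqYZ; rewrite mulrCA -!(scalerA x) -scalerDr eqYZ scalerDr.
  by rewrite !(scalerA _ _ Z) mulrC.
(* The products of traces cover [c.*2 < L] and the derivative terms cover the complementary range.
   In both the binomial has upper entry L - 1 - 2c, so together they form the full sum of
   [sum_cat_gbin] at x = L. *)
pose lhs := \sum_(c < m.+1) cat c *:
  (if (c.*2 < L)%N then trmul_lim (L - 1 - c.*2) (m - c) P else 0).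
pose rhs := \sum_(c < m.+1) cat c *:
  (if (L <= c.*2)%N then b_lim (c.*2 - L).+1 (m - c) P else 0).
have left_sum : \sum_(a < L) \sum_(c < m.+1)
    lead a c *: trmul_lim (L - 1 - a) (m - c) P = lhs.
  rewrite exchange_big; apply: eq_bigr => c _.
  have := sum_lead 0 L (fun a => trmul_lim (L - 1 - a) (m - c) P) c.
  by rewrite add0n subn0 /= => ->; case: ifP; rewrite ?scaler0.
(* The reflection of [a] and [c] exchanges the two factors of the quadratic term. *)
have right_sum : \sum_(a < L) \sum_(c < m.+1)
    lead (L - 1 - a) (m - c) *: trmul_lim a c P = lhs.
  rewrite -left_sum (reindex_inj rev_ord_inj); apply: eq_bigr => a _.
  rewrite (reindex_inj rev_ord_inj); apply: eq_bigr => c _ /=.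
  have le_cm : (c <= m)%N by rewrite -ltnS.
  have -> : (m - (m - c) = c)%N by rewrite subKn.
  have eq_a : (L - a.+1 = L - 1 - a)%N by rewrite -subnDA.
  have -> : (L - 1 - (L - a.+1) = a)%N by case: a {eq_a} => a /= lt_aL; lia.
  by rewrite eq_a.
have b_sum : \sum_(j < E) \sum_(c < m.+1)
    lead (L + j) c *: b_lim j.+1 (m - c) P = rhs.
  rewrite exchange_big; apply: eq_bigr => c _.
  rewrite (sum_lead L E (fun j => b_lim j.+1 (m - c) P)).
  have -> : (c.*2 < L + E)%N by case: c => c /= le_cm; lia.
  by rewrite andbT; case: ifP; rewrite ?scaler0.
under eq_bigr => a _ do rewrite big_split /=.
rewrite big_split /= left_sum right_sum b_sum.
have -> : lhs = gbin L%:R m *: mode (L.+1%:Z - m.+1.*2%:Z) P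
    + ((L.+1 == m.+1.*2)%:R *
       \sum_(c < m.+1) cat c * subleading (m - c)) *: P - kappa^-1 *: rhs.
  apply/eqP; rewrite eq_sym subr_eq; apply/eqP.
  rewrite -(sum_cat_gbin _ m) mulr_sumr !scaler_suml scaler_sumr -!big_split.
  apply: eq_bigr => c _ /=; have le_cm : (c <= m)%N by rewrite -ltnS.
  apply: factor.
  case: ltnP => [lt_cL|le_Lc].
    rewrite scaler0 addr0 /trmul_lim.
    congr (gbin _ _ *: mode _ _ + (_%:R * _) *: _).
    - by rewrite -subnDA natrB -?natr1 //; ring.
    - by lia.
    - by apply/eqP/eqP; lia.
  rewrite add0r /b_lim.
  have /negPf-> : L.+1 != m.+1.*2 by lia.
  rewrite mul0r scale0r addr0 (scalerA kappa^-1) scalerA mulrAC mulVf // mul1r.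
  congr (gbin _ _ *: mode _ _); last by lia.
  by rewrite -(natr1 (_ - _)) natrB //; ring.
set S := \sum_(c < m.+1) _.
set W := gbin _ _ *: _ + (_ * S) *: P; clearbody lhs rhs.
(* The term linear in the traces, with coefficient k, tends to a scalar that is nonzero only at L +
   1 = 2(m+1); it is the last term in the recurrence of [subleading]. *)
transitivity ((L.+1%:R / m.+1%:R) *:
  (W - (k%:R * L%:R / (2 * kappa) * lead (L - 1) m) *: P)).
  rewrite /trmul_lim gbinS -(natr1 L) addrK natr1 -scalerA.
  rewrite scalerBr /W scalerDr -addrA; congr (_ + _).
  rewrite !scalerA -scalerBl; congr (_ *: _); rewrite /lead.
  have [eqL|neL] := eqVneq L.+1 m.+1.*2; last first.
    (* For L = 0 the truncated index [L - 1] is 0 and [lead] may be nonzero; the factor L removes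
       it. *)
    case: (posnP L) => [->|L_gt0].
      by rewrite !mul0r !(mulr0, mul0r) subrr.
    have /negPf-> : (L - 1)%N != m.*2 by lia.
    by rewrite !mul0r !mulr0 subrr.
  have -> : L = m.*2.+1 by lia.
  rewrite subn1 eqxx !mul1r subleadingE -/S.
  have -> : m.*2.+2%:R = 2 * m.+1%:R :> C by rewrite -natrM mul2n.
  by field; rewrite !nat1r !pnatr_eq0.
set G := (- _ / _) *: _.
have -> : G = - ((2 * (k%:R * L%:R / (2 * kappa) * lead (L - 1) m)) *: P).
  rewrite /G scalerA -scaleNr natrM; congr (_ *: _).
  by field; rewrite !nat1r !pnatr_eq0.
have -> : (2 / kappa) *: rhs = 2 *: (kappa^-1 *: rhs) by rewrite scalerA.
have -> : L.+1%:R / m.+1%:R = L.+1%:R / (2 * m.+1%:R) * 2 :> C.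
  by field; rewrite !nat1r !pnatr_eq0.
have double (w x y : V) :
    2 *: (w - y) = w - x + (w - x) + (- (2 *: y) + 2 *: x).
  by rewrite -mulr2n -scaler_nat !scalerBr [- _ + _]addrC addrA subrK.
by rewrite -[LHS]scalerA -(scalerA 2 _ P) (double W (kappa^-1 *: rhs)).
Qed.

End Step.

(** At m = 0 the only divergent case is L = 0, where the trace is exactly N and [lead 0 0 = 1]
    removes all of it. For larger m each family needs both families at all smaller orders. *)
Theorem dpow_tends m :
  (forall L, tends_op h (fun N => trmul_rem N L m) (trmul_lim L m)) /\
  (forall j, (0 < j)%N -> tends_op h (fun N => dpow (T N) m (b j)) (b_lim j m)).
Proof.
elim/ltn_ind: m => -[_|m IHm]; last first.
  have IHp c L : (c <= m)%N ->
      tends_op h (fun N => trmul_rem N L c) (trmul_lim L c).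
    by move=> le_cm; case: (IHm c le_cm) => + _; apply.
  have IHb c j : (c <= m)%N -> (0 < j)%N ->
      tends_op h (fun N => dpow (T N) c (b j)) (b_lim j c).
    by move=> le_cm j_gt0; case: (IHm c le_cm) => _; apply.
  by split=> [L|j j_gt0]; [exact: dpow_trmul_step|exact: dpow_b_step].
split=> [L|j j_gt0]; split=> [N||P].
- exact: trmul_rem_linear.
- exact: trmul_lim_linear.
- apply: tends_ext (tends_cst h _) => N _.
  rewrite /trmul_rem /trmul_lim /lead dpow0 cat0 mulr1 subleadingE mulr0.
  rewrite scale0r addr0 scale1r subr0; case: L => [|L] /=.
    by rewrite mulr1 subrr.
  by rewrite mulr0 scale0r subr0.
- exact: dpow_linear.
- exact: b_lim_linear.
- apply: tends_ext (tends_cst h _) => N _.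
  rewrite /b_lim dpow0 scale1r addn0; case: j j_gt0 => // j _ /=.
  by rewrite scalerA mulfV ?scale1r.
Qed.

End CollectiveModes.

(** * The Hamiltonian on polynomials in the traces *)

Section CollectiveHamiltonian.
Variables (C : numFieldType) (V : comAlgType C) (k : nat) (h : nat -> C).
Variables (x : nat -> V) (b : nat -> V -> V) (F : int -> V -> Prop).
Variable deg : V -> nat.

Local Notation kappa := (k.+1%:R : C).

Hypothesis b_linear : forall i, linear (b i).
Hypothesis b_zero : forall P, b 0 P = 0.
Hypothesis b_der : forall i P Q, b i (P * Q) = b i P * Q + P * b i Q.
Hypothesis b_x : forall i j, (0 < j)%N -> b i (x j) = ((i == j)%:R * i%:R)%:A.
Hypothesis b_comm : forall i j P, b i (b j P) = b j (b i P).
Hypothesis F_linear : forall e a P Q, F e P -> F e Q -> F e (a *: P + Q).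
Hypothesis F_0 : forall e, F e 0.
Hypothesis F_le : forall (e e' : int) P, e <= e' -> F e P -> F e' P.
Hypothesis F_neg : forall (e : int) P, e < 0 -> F e P -> P = 0.
Hypothesis F_deg : forall P, F (deg P) P.
Hypothesis F_x : forall i e P, (0 < i)%N -> F e P -> F (e + i%:Z) (x i * P).
Hypothesis F_b : forall i e P, F e P -> F (e - i%:Z) (b i P).

Definition power_sum (N i : nat) := if i is 0 then (N%:R)%:A else x i.

(** The first-order coefficient for the variable of index i + 1: the Laplacian of that trace and
    twice its gradient against the ground state, divided by the ground state, by i + 1 and by
    [h N]. *)
Definition drift N i :=
  kappa *: (\sum_(a < i) power_sum N a * power_sum N (i.-1 - a))
  - (k * i)%:R *: power_sum N i.-1.

Definition ham_upto (N J : nat) P := h N *: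
  (\sum_(i < J) drift N i * b i.+1 P
   + \sum_(i < J) \sum_(j < J) power_sum N (i + j) * b i.+1 (b j.+1 P)).

(** The Hamiltonian has infinitely many terms, but those beyond the energy of [P] annihilate it. The
    cutoff may be any energy bound, by [hamE]. *)
Definition ham N P := ham_upto N (deg P) P.

Let b_0 i : b i 0 = 0.
Proof. by have := b_linear i (-1) 0 0; rewrite !scaleN1r !addNr. Qed.

Let b_Z i a P : b i (a *: P) = a *: b i P.
Proof. by have := b_linear i a P 0; rewrite b_0 !addr0. Qed.

Let b_D i P Q : b i (P + Q) = b i P + b i Q.
Proof. by have := b_linear i 1 P Q; rewrite !scale1r. Qed.

Let b_sum i (I : Type) (r : seq I) (f : I -> V) :
  b i (\sum_(j <- r) f j) = \sum_(j <- r) b i (f j).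
Proof. exact: (big_morph (b i) (b_D i) (b_0 i)). Qed.

Let b_1 i : b i 1 = 0.
Proof.
have := b_der i 1 1; rewrite !mulr1 mul1r => eq_b.
by apply: (addrI (b i 1)); rewrite addr0 -eq_b.
Qed.

Let b_power_sum N i a : (0 < i)%N ->
  b i (power_sum N a) = ((i == a)%:R * i%:R)%:A.
Proof.
case: a => [|a] i_gt0; last exact: b_x.
by rewrite b_Z b_1 scaler0 eqn0Ngt i_gt0 mul0r scale0r.
Qed.

Lemma F_Z e (a : C) P : F e P -> F e (a *: P).
Proof. by move=> FP; rewrite -[_ *: _]addr0; apply: F_linear. Qed.

Lemma F_D e P Q : F e P -> F e Q -> F e (P + Q).
Proof. by move=> FP FQ; rewrite -[P]scale1r; apply: F_linear. Qed.

Lemma F_sum e (I : Type) (r : seq I) (f : I -> V) :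
  (forall i, F e (f i)) -> F e (\sum_(i <- r) f i).
Proof. by move=> Ff; elim/big_rec: _ => // i P _; exact: F_D. Qed.

Lemma F_power_sum N i e P : F e P -> F (e + i%:Z) (power_sum N i * P).
Proof.
by case: i => [|i] FP /=; [rewrite mulr_algl addr0; exact: F_Z|exact: F_x].
Qed.

Lemma b_vanish i (e : int) P : e < i%:Z -> F e P -> b i P = 0.
Proof. by move=> lt_ei /(F_b i) FbP; apply: F_neg FbP; lia. Qed.

Lemma ham_upto_stable N (E J : nat) P : (E <= J)%N -> F E P ->
  ham_upto N J P = ham_upto N E P.
Proof.
move=> le_EJ FP; rewrite /ham_upto; congr (_ *: (_ + _)).
  rewrite (big_ord_widen _ (fun i => drift N i * b i.+1 P) le_EJ).
  rewrite [RHS]big_mkcond; apply: eq_bigr => i _ /=.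
  by case: ltnP => // le_Ei; rewrite (b_vanish _ FP) ?mulr0 // ltz_nat ltnS.
rewrite (big_ord_widen _ (fun i => \sum_(j < E) power_sum N (i + j) *
  b i.+1 (b j.+1 P)) le_EJ) [RHS]big_mkcond; apply: eq_bigr => i _ /=.
case: ltnP => // le_Ei; last first.
  rewrite big1 // => j _.
  by rewrite b_comm (b_vanish _ FP) ?b_0 ?mulr0 // ltz_nat ltnS.
rewrite (big_ord_widen _ (fun j => power_sum N (i + j) *
  b i.+1 (b j.+1 P)) le_EJ) [RHS]big_mkcond; apply: eq_bigr => j _ /=.
by case: ltnP => // le_Ej; rewrite (b_vanish _ FP) ?b_0 ?mulr0 // ltz_nat ltnS.
Qed.

Lemma hamE N (E : nat) P : F E P -> ham N P = ham_upto N E P.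
Proof.
move=> FP; rewrite /ham; have [le_degE|/ltnW le_Edeg] := leqP (deg P) E.
  by rewrite (ham_upto_stable _ le_degE).
by rewrite -(ham_upto_stable _ le_Edeg FP).
Qed.

Lemma ham_linear N : linear (ham N).
Proof.
(* The cutoff [deg] is not additive, so all three values are computed with a common one. *)
move=> a P Q; pose E := maxn (deg P) (deg Q).
have FP : F E P by apply: F_le (F_deg P); rewrite lez_nat leq_maxl.
have FQ : F E Q by apply: F_le (F_deg Q); rewrite lez_nat leq_maxr.
rewrite (hamE _ FP) (hamE _ FQ) (hamE _ (F_linear a FP FQ)) /ham_upto.
rewrite (scalerA a) [a * h N]mulrC -(scalerA _ a) -scalerDr; congr (_ *: _).
rewrite scalerDr addrACA !scaler_sumr -!big_split /=.
apply: eq_bigr => i _; congr (_ + _).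
  by rewrite b_linear mulrDr scalerAr.
rewrite scaler_sumr -big_split /=.
by apply: eq_bigr => j _; rewrite !b_linear mulrDr scalerAr.
Qed.

Lemma F_drift N i e P : F e P -> F (e + i%:Z - 1) (drift N i * P).
Proof.
case: i => [|i] FP.
  by rewrite /drift big_ord0 scaler0 muln0 scale0r subrr mul0r.
have -> : e + i.+1%:Z - 1 = e + i%:Z by lia.
rewrite /drift mulrDl mulNr -!scalerAl; apply: F_D; last first.
  by rewrite -scaleNr; apply: F_Z; exact: F_power_sum.
apply: F_Z; rewrite mulr_suml; apply: F_sum => -[a /= lt_ai].
have -> : e + i%:Z = e + (i - a)%:Z + a%:Z by lia.
by rewrite -mulrA; do 2!apply: F_power_sum.
Qed.

(** Both kinds of terms lower the energy by two: (i - 1) - (i + 1) for the drift, (i + j) - (i + 1)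
    - (j + 1) for the second-order part. *)
Lemma F_ham N e P : F e P -> F (e - 2) (ham N P).
Proof.
move=> FP; apply: F_Z; apply: F_D; apply: F_sum => i.
  by apply: F_le (F_drift N i (F_b i.+1 FP)); lia.
apply: F_sum => j.
by apply: F_le (F_power_sum N (i + j) (F_b i.+1 (F_b j.+1 FP))); lia.
Qed.

Local Notation trm := (trmul (fun i P => x i * P)).

Let trE N i Q : trm N i Q = power_sum N i * Q.
Proof. by case: i => //=; rewrite mulr_algl. Qed.

Let sum_delta (n c : nat) (a : C) (f : nat -> V) : (c < n)%N ->
  \sum_(i < n) ((i == c :> nat)%:R * a) *: f i = a *: f c.
Proof.
move=> lt_cn; rewrite (bigD1 (Ordinal lt_cn)) //= eqxx mul1r big1 ?addr0 //.
move=> i; rewrite -(inj_eq val_inj) /= => /negPf->.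
by rewrite mul0r scale0r.
Qed.

(** Multiplication by [p_L] is differentiated once, either in the first-order part, which returns
    the drift, or by one of the two derivatives of the symmetric second-order part, whence the
    factor 2. *)
Lemma ham_trmul N (L E : nat) P : F E P ->
  ad (ham N) (trm N L) P = (h N * L%:R) *:
    (kappa *: (\sum_(a < L.-1) trm N a (trm N (L - 2 - a) P))
     - (k * L.-1)%:R *: trm N (L - 2) P
     + 2 *: (\sum_(j < E) trm N (L + j).-1 (b j.+1 P))).
Proof.
move=> FP; case: L => [|L].
  rewrite mulr0 scale0r /ad /=; have h0 : ham N 0 = 0.
    by have := ham_linear N (-1) 0 0; rewrite !scaleN1r !addNr.
  by have := ham_linear N N%:R P 0; rewrite h0 !addr0 => ->; rewrite subrr.
pose J := (E + L.+1)%N.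
have FJP : F J P by apply: F_le FP; rewrite lez_nat leq_addr.
have FJLP : F J (power_sum N L.+1 * P) by rewrite /J PoszD; apply: F_x.
rewrite /ad !trE (hamE N FJP) (hamE N FJLP) /ham_upto -scalerAr -scalerBr.
rewrite -(scalerA (h N)); congr (_ *: _).
have b_wP i Q : b i.+1 (power_sum N L.+1 * Q) =
    ((i == L)%:R * L.+1%:R) *: Q + power_sum N L.+1 * b i.+1 Q.
  rewrite b_der b_power_sum // mulr_algl eqSS.
  by case: eqP => [->|_]; rewrite ?mul0r.
under eq_bigr => i _ do rewrite b_wP mulrDr -scalerAr mulrCA.
under [X in _ + X - _]eq_bigr => i _ do
  under eq_bigr => j _ do rewrite b_wP b_D b_Z b_wP !mulrDr -!scalerAr
    (mulrCA (power_sum N (i + j))).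
rewrite mulrDr !mulr_sumr big_split /=.
under [X in _ + X - _]eq_bigr => i _ do rewrite !big_split /= -scaler_sumr.
rewrite !big_split /=.
under [X in _ - (_ + X)]eq_bigr => i _ do rewrite mulr_sumr.
rewrite (addrA (\sum_(i < J) \sum_(j < J) _)) addrACA addrK.
have lt_LJ : (L < J)%N by rewrite /J addnS ltnS leq_addl.
rewrite (sum_delta _ (fun i => drift N i * P)) //.
rewrite (sum_delta _ (fun i => \sum_(j < J) power_sum N (i + j) * b j.+1 P)) //.
have -> : \sum_(i < J) \sum_(j < J)
    ((j == L :> nat)%:R * L.+1%:R) *: (power_sum N (i + j) * b i.+1 P) =
    L.+1%:R *: (\sum_(i < J) power_sum N (L + i) * b i.+1 P).
  rewrite scaler_sumr; apply: eq_bigr => i _.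
  by rewrite (sum_delta _ (fun j => power_sum N (i + j) * b i.+1 P)) // addnC.
have -> : \sum_(i < J) power_sum N (L + i) * b i.+1 P =
    \sum_(j < E) trm N (L + j) (b j.+1 P).
  have le_EJ : (E <= J)%N by exact: leq_addr.
  rewrite (big_ord_widen _ (fun j => trm N (L + j) (b j.+1 P)) le_EJ).
  rewrite [RHS]big_mkcond; apply: eq_bigr => j _; rewrite trE.
  by case: ltnP => // le_Ej; rewrite (b_vanish _ FP) ?mulr0 // ltz_nat ltnS.
rewrite -!scalerDr -mulr2n -scaler_nat; congr (_ *: (_ + _)).
rewrite /drift mulrBl -!scalerAl mulr_suml subSS subn1.
by congr (_ *: _ - _); apply: eq_bigr => i _; rewrite !trE mulrA.
Qed.

(** Since the derivations commute, [b j] only differentiates the coefficients of the Hamiltonian: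
    the drift gives the first two terms, the second-order coefficients the last. *)
Lemma ham_b N j (E : nat) P : F E P ->
  ad (ham N) (b j) P = - (h N * j%:R) *:
    ((2 * kappa) *: (\sum_(l < E) trm N l (b (j + 2 + l) P))
     - (k * j.+1)%:R *: b (j + 2) P
     + \sum_(i < j.+1) b i.+1 (b (j.+1 - i) P)).
Proof.
move=> FP; case: j => [|j].
  rewrite mulr0 oppr0 scale0r /ad !b_zero subr0; have := ham_linear N (-1) 0 0.
  by rewrite !scaleN1r !addNr.
(* This shape lets the sums split at [m.+1]: the derivative of [drift N i] vanishes below it, that
   of [power_sum N (i + j)] from there on. *)
set m := j.+1; pose J := (m.+1 + E.+1)%N.
have FJP : F J P by apply: F_le FP; rewrite /J; lia.
have FJbP : F J (b m P) by apply: F_le (F_b m FP); rewrite /J; lia.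
rewrite /ad (hamE N FJP) (hamE N FJbP) /ham_upto b_Z -scalerBr.
rewrite -mulrN -(scalerA (h N)); congr (_ *: _).
rewrite b_D !b_sum.
under [X in _ - (X + _)]eq_bigr => i _ do rewrite b_der (b_comm m i.+1).
under [X in _ - (_ + X)]eq_bigr => i _ do
  (rewrite b_sum; under eq_bigr => l _ do
     rewrite b_der (b_comm m i.+1) (b_comm m l.+1); rewrite big_split /=).
rewrite !big_split /= (addrACA (\sum_(i < J) b m _ * _)) opprD addrCA.
rewrite subrr addr0.
rewrite scaleNr; congr (- _).
have b_ps a : b m (power_sum N a) = ((a == m :> nat)%:R * m%:R)%:A.
  by rewrite b_power_sum // eq_sym.
have b_drift i : b m (drift N i) =
    m%:R *: ((2 * kappa) *: ((m < i)%:R *: power_sum N (i.-1 - m))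
             - (k * i)%:R *: (i.-1 == m)%:R%:A).
  rewrite /drift b_D b_Z -scaleN1r b_Z scaleN1r b_Z b_ps b_sum.
  under eq_bigr => a _ do rewrite b_der !b_ps mulr_algl mulr_algr.
  (* One factor of each product is differentiated; the other case is its mirror image under reversal
     of [a], hence 2 kappa. *)
  have half : \sum_(a < i) ((a == m :> nat)%:R * m%:R) *: power_sum N (i.-1 - a)
      = m%:R *: ((m < i)%:R *: power_sum N (i.-1 - m)).
    case: ltnP => [lt_mi|le_im].
      by rewrite (sum_delta _ (fun a => power_sum N (i.-1 - a))) // scale1r.
    rewrite scale0r scaler0 big1 // => a _; rewrite ltn_eqF ?mul0r ?scale0r //.
    exact: leq_trans (ltn_ord a) le_im.
  rewrite big_split /= half (reindex_inj rev_ord_inj) /=.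
  under eq_bigr => a _.
    rewrite (_ : i.-1 - (i - a.+1) = a)%N; last by case: a => a /= lt_ai; lia.
    rewrite (_ : i - a.+1 = i.-1 - a)%N; last by case: a => a /= lt_ai; lia.
    over.
  rewrite half -mulr2n -scaler_nat !scalerBr !scalerA.
  by congr (_ *: _ - _ *: _); ring.
rewrite !scalerDr; congr (_ + _).
  under [LHS]eq_bigr => i _ do rewrite b_drift.
  rewrite big_split_ord /= big1 ?add0r => [|i _]; last first.
    rewrite ltnNge -ltnS ltn_ord scale0r scaler0 (_ : (i.-1 == m) = false).
      by rewrite scale0r !scaler0 subrr scaler0 mul0r.
    by apply/negP=> /eqP; case: i => -[|i] /= lt_im; lia.
  under [LHS]eq_bigr => l _.
    rewrite (_ : (m < m.+1 + l)%N) ?ltn_addr // scale1r.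
    rewrite (_ : (m.+1 + l).-1 - m = l)%N; last by lia.
    rewrite (_ : ((m.+1 + l).-1 == m) = (l == 0 :> nat)); last by lia.
    rewrite -scalerAl mulrBl -!scalerAl mul1r -addSn -[m.+2]addn2.
    over.
  rewrite -[RHS]scalerDr -scaler_sumr sumrB; congr (_ *: (_ - _)).
    rewrite scaler_sumr big_ord_recr /= (b_vanish _ FP) ?mulr0 ?scaler0 ?addr0.
      by apply: eq_bigr => l _; rewrite trE.
    by lia.
  rewrite big_ord_recl /= scale1r !addn0 big1 ?addr0 // => l _.
  by rewrite scale0r !scaler0.
rewrite big_split_ord /= [X in _ + X]big1 => [|l _]; last first.
  rewrite big1 // => j' _.
  rewrite b_x // ltn_eqF ?mul0r ?scale0r ?mul0r //.
  by rewrite -addnA addSn ltnS leq_addr.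
rewrite addr0 scaler_sumr; apply: eq_bigr => i _.
have le_im : (i <= m)%N by rewrite -ltnS.
under eq_bigr => j' _.
  rewrite b_ps (_ : (i + j' == m)%N = (j' == m - i :> nat)%N); last by lia.
  rewrite mulr_algl; over.
rewrite (sum_delta _ (fun l => b i.+1 (b l.+1 P))) ?(subSn le_im) //.
by rewrite /J; lia.
Qed.

(** Each commutator lowers the energy by two; for L = m + n the total shift is exactly n - m. *)
Lemma F_dpow N m L e P : F e P ->
  F (e + L%:Z - m.*2%:Z) (dpow (ham N) m (trm N L) P).
Proof.
elim: m e P => [|m IHm] e P FP.
  by rewrite dpow0 trE subr0; exact: F_power_sum.
rewrite dpowS; last exact: ham_linear.
apply: F_Z; apply: F_D; last rewrite -scaleN1r; last apply: F_Z.
  by apply: F_le (F_ham N (IHm _ _ FP)); lia.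
by apply: F_le (IHm _ _ (F_ham N FP)); lia.
Qed.

Lemma mode_commutator (a c : int) P : a <> 0 -> c <> 0 ->
  let al := mode k (fun i P => x i * P) b in
  al a (al c P) - al c (al a P) =
  (kappa^-1 * (- a)%:~R * (a == - c)%:R) *: P.
Proof.
have b_xP i j Q : b i.+1 (x j.+1 * Q) =
    x j.+1 * b i.+1 Q + ((i == j)%:R * i.+1%:R) *: Q.
  by rewrite b_der b_x // mulr_algl eqSS addrC.
case: a c => [[|i]|i] [[|j]|j] // _ _ /=.
- by rewrite mulrCA subrr mulr0 scale0r.
- rewrite b_xP scalerDr scalerA opprD -scalerAr addrA subrr add0r -scaleNr.
  congr (_ *: _); rewrite NegzE opprK eqz_nat eqSS eq_sym.
  by case: eqP => [->|_];
    rewrite !(mul0r, mul1r, mulr0, mulr1) ?oppr0 ?mulrN ?mulrz_nat.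
- rewrite b_xP scalerDr scalerA -scalerAr addrAC subrr add0r.
  congr (_ *: _); rewrite NegzE opprK eqr_opp eqz_nat eqSS.
  by case: eqP => [->|_]; rewrite !(mul0r, mul1r, mulr0, mulr1).
- rewrite !b_Z b_comm subrr.
  by rewrite mulr0 scale0r.
Qed.

Hypothesis hE : forall N, (0 < N)%N -> h N * (kappa * N%:R) = 1.

Theorem dpow_ham_tends m L : tends_op h
  (fun N => trmul_rem ham (fun i P => x i * P) N L m)
  (trmul_lim k (fun i P => x i * P) b L m).
Proof.
have x_linear i : linear (fun P => x i * P).
  by move=> a P Q; rewrite mulrDr scalerAr.
apply: (proj1 (@dpow_tends _ _ k h (fun E : nat => F E) ham _ b hE
  _ _ ham_linear x_linear b_linear ham_trmul ham_b m)).
- by move=> E N P FP; apply: F_le (F_ham N FP); lia.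
- move=> P n; exists (maxn n (deg P)); first exact: leq_maxl.
  by apply: F_le (F_deg P); rewrite lez_nat leq_maxr.
Qed.

End CollectiveHamiltonian.

(** * Bosonic Fock space *)

Lemma linear_fun0 (R : pzRingType) (U W : lmodType R) (f : U -> W) :
  linear f -> f 0 = 0.
Proof. by move=> linf; have := linf (-1) 0 0; rewrite !scaleN1r !addNr. Qed.

Lemma linear_funZ (R : pzRingType) (U W : lmodType R) (f : U -> W) a u :
  linear f -> f (a *: u) = a *: f u.
Proof.
by move=> linf; have := linf a u 0; rewrite (linear_fun0 linf) !addr0.
Qed.

Module BosonicTheory.
Import finmap monalg.

(* Sealed copies: unification would otherwise unfold the finitely supported
   functions. *)
HB.lock Definition bmon (C : numClosedFieldType) (u : monom) := of_monom C u.

HB.lock Definition bvar (C : numClosedFieldType) n := ptilde C n.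

HB.lock Definition modeb (C : numClosedFieldType) n (P : bosonic C) :=
  n%:R *: dptilde n P.

Lemma scale_linear (R : comNzRingType) (U W : lmodType R) c (f : U -> W) :
  linear f -> linear (fun u => c *: f u).
Proof. by move=> linf a u v; rewrite linf scalerDr !scalerA mulrC. Qed.

Lemma scale_comm (R : comNzRingType) (U : lmodType R) (a b : R) (u v : U) :
  u = v -> a *: (b *: u) = b *: (a *: v).
Proof. by move=> ->; rewrite !scalerA mulrC. Qed.

Lemma leibniz_linear (R : comNzRingType) (V : comAlgType R) (d : V -> V) Q :
  linear d ->
  linear (fun P => d (P * Q)) /\ linear (fun P => d P * Q + P * d Q).
Proof.
move=> lind; split=> a u v; rewrite ?lind !mulrDl -!scalerAl ?lind //.
by rewrite scalerDr addrACA.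
Qed.

(** Arithmetic of Leibniz's rule on monomials: [divcm] truncates, so the quotients agree only when
    the exponent, which is also the weight, is nonzero. *)
Lemma scale_weights (R : nzRingType) (V : lmodType R) (a : R) (x y : nat)
    (w w1 w2 : V) :
  (x != 0 -> w = w1)%N -> (y != 0 -> w = w2)%N ->
  (a * (x + y)%:R) *: w = (a * x%:R) *: w1 + (a * y%:R) *: w2.
Proof.
rewrite natrD mulrDr scalerDl; case: x => [|x] eq_w1.
  case: y => [|y] eq_w2; first by rewrite mulr0 !scale0r.
  by rewrite mulr0 !scale0r eq_w2.
case: y => [|y] eq_w2; first by rewrite mulr0 !scale0r eq_w1.
by rewrite -eq_w1 -?eq_w2.
Qed.

Section Monomials.
Variable C : numClosedFieldType.
Local Notation V := (bosonic C).
Local Notation mon := (bmon C).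
Local Notation modeb := (@modeb C).

Lemma coef_linear u : linear_for *%R (coef u : V -> C).
Proof. by move=> a P Q; rewrite /coef mcoeffD mcoeffZ. Qed.

Lemma coef_of_monom u v : coef u (mon v) = (v == u)%:R.
Proof. by rewrite bmon.unlock; exact: mcoeffU1. Qed.

Lemma bosonicP (P Q : V) : (forall u, coef u P = coef u Q) -> P = Q.
Proof. by move/malgP. Qed.

Lemma monomialE (c : C) u : (<< c *g u >> : V) = c *: mon u.
Proof.
apply/malgP => v; transitivity (c * (u == v)%:R).
  by rewrite mulr_natr; exact: mcoeffU.
by rewrite -coef_of_monom; symmetry; exact: mcoeffZ.
Qed.

Lemma bosonicE (P : V) : P = \sum_(u <- msupp P) coef u P *: (mon u).
Proof.
rewrite {1}[P]monalgE; apply: eq_bigr => u _.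
exact: monomialE.
Qed.

Lemma of_monomM (u v : monom) : (mon u) * (mon v) = mon (mulcm u v).
Proof. by rewrite bmon.unlock /of_monom malgM_def fgmulUU mulr1. Qed.

Lemma of_monom1 : mon (onecm nat) = 1.
Proof. by rewrite bmon.unlock. Qed.

Lemma dptilde_linear n : linear (dptilde n : V -> V).
Proof.
have dptildeE (P : V) (d : {fset monom}) : (msupp P `<=` d)%fset ->
    dptilde n P = \sum_(u <- d)
      (mcoeff u P * (u n.-1)%:R) *: mon (divcm u (ucm n.-1)).
  move=> sPd; rewrite /dptilde (big_fset_incl _ sPd) => [|u _]; last first.
    by move=> /mcoeff_outdom->; rewrite mul0rn monalgU0.
  apply: eq_bigr => u _; apply: etrans (monomialE _ _) _.
  exact: (congr1 ( *:%R ^~ _) (esym (mulr_natr _ _))).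
move=> a P Q; pose d := (msupp (a *: P + Q) `|` msupp P `|` msupp Q)%fset.
rewrite !(dptildeE _ d) ?fsubsetUr //; last 2 first.
- by rewrite fsubsetU // fsubsetUr.
- by rewrite fsubsetU // fsubsetUl.
rewrite scaler_sumr -big_split /=; apply: eq_bigr => u _.
by rewrite mcoeffD mcoeffZ mulrDl scalerDl -mulrA scalerA.
Qed.

Lemma dptilde_of_monom n u :
  dptilde n (mon u) = (u n.-1)%:R *: mon (divcm u (ucm n.-1)).
Proof.
rewrite {1}bmon.unlock /dptilde msuppU1 big_seq_fset1 mcoeffU1 eqxx.
exact: monomialE.
Qed.

Lemma monom_divM (u : monom) i :
  (0 < u i)%N -> u = mulcm (divcm u (ucm i)) (ucm i).
Proof.
move=> ui_gt0; apply/eqP/cmP => j; rewrite mulcmE divcmE ucmE.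
by case: eqP => [<-|_]; rewrite ?subnK ?subn0 ?addn0.
Qed.

Lemma energyM (u v : monom) : energy (mulcm u v) = (energy u + energy v)%N.
Proof.
have energyE (w : monom) (d : {fset nat}) : (finsupp w `<=` d)%fset ->
    energy w = (\sum_(i <- d) i.+1 * w i)%N.
  move=> swd; apply: big_fset_incl => // i _; rewrite -cmE_eq0 => /eqP->.
  by rewrite muln0.
pose d := (finsupp (mulcm u v) `|` finsupp u `|` finsupp v)%fset.
rewrite !(energyE _ d) ?fsubsetUr //; last 2 first.
- by rewrite fsubsetU // fsubsetUr.
- by rewrite fsubsetU // fsubsetUl.
by rewrite -big_split /=; apply: eq_bigr => i _; rewrite mulcmE mulnDr.
Qed.

Lemma energy_ucm i : energy (ucm i) = i.+1.
Proof. by rewrite /energy mdomU big_seq_fset1 ucmE eqxx muln1. Qed.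

Lemma energy_coord (u : monom) i : (i.+1 * u i <= energy u)%N.
Proof.
have [->|ui_neq0] := eqVneq (u i) 0%N; first by rewrite muln0.
rewrite /energy (big_fsetD1 i) ?leq_addr //=.
by rewrite -cmE_neq0.
Qed.

Lemma bvarE n : bvar C n = mon (ucm n.-1).
Proof. by rewrite bvar.unlock bmon.unlock. Qed.

Lemma bvarS n : bvar C n.+1 = mon (ucm n).
Proof. exact: bvarE. Qed.

(** Integer bounds avoid truncated subtraction: lowering below energy 0 is a negative bound, which
    forces the polynomial to vanish. *)
Definition energy_bound (e : int) (P : V) :=
  forall u, coef u P != 0 -> (energy u)%:Z <= e.

Definition max_energy (P : V) := \max_(u <- msupp P) energy u.

Lemma energy_leP (E : nat) (P : V) :
  reflect (energy_bound E P) (P \in energy_le C E).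
Proof.
rewrite /energy_le inE; apply: (iffP allP) => bP u.
  by rewrite mcoeff_neq0 => /bP.
by rewrite -mcoeff_neq0 => /bP.
Qed.

Lemma energy_bound_linear e (a : C) (P Q : V) :
  energy_bound e P -> energy_bound e Q -> energy_bound e (a *: P + Q).
Proof.
move=> bP bQ u; rewrite coef_linear.
have [Pu0|/bP //] := eqVneq (coef u P) 0.
by rewrite Pu0 mulr0 add0r => /bQ.
Qed.

Lemma energy_bound0 e : energy_bound e 0.
Proof. by move=> u; rewrite /coef mcoeff0 eqxx. Qed.

Lemma energy_bound_le (e e' : int) P :
  e <= e' -> energy_bound e P -> energy_bound e' P.
Proof. by move=> le_e bP u /bP le_u; apply: le_trans le_u le_e. Qed.

Lemma energy_bound_neg (e : int) P : e < 0 -> energy_bound e P -> P = 0.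
Proof.
move=> e_lt0 bP; apply: bosonicP => u; apply/eqP.
rewrite [coef u 0]mcoeff0; apply: contraTT e_lt0 => /bP le_u.
by rewrite -leNgt (le_trans _ le_u).
Qed.

Lemma energy_bound_max P : energy_bound (max_energy P) P.
Proof.
move=> u; rewrite mcoeff_neq0 => Pu.
by rewrite lez_nat; apply: leq_bigmax_seq Pu _.
Qed.

Lemma energy_bound_of_monom u : energy_bound (energy u) (mon u).
Proof.
move=> v; rewrite coef_of_monom; case: (u =P v) => [->//|_].
by rewrite eqxx.
Qed.

Lemma energy_bound_map (f : V -> V) e e' P : linear f ->
  (forall u, (energy u)%:Z <= e -> energy_bound e' (f (mon u))) ->
  energy_bound e P -> energy_bound e' (f P).
Proof.
move=> linf fX bP; rewrite [P]bosonicE.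
have f0 : f 0 = 0 by exact: linear_fun0.
elim/big_rec: _ => [|u Q _ bQ].
  by rewrite f0; exact: energy_bound0.
have [->|Pu] := eqVneq (coef u P) 0; first by rewrite scale0r add0r.
by rewrite linf; apply: energy_bound_linear => //; apply: fX; apply: bP.
Qed.

Lemma bosonic_linear_ext (W : lmodType C) (f g : V -> W) :
  linear f -> linear g -> (forall u, f (mon u) = g (mon u)) -> f =1 g.
Proof.
move=> linf ling eq_fg P; rewrite [P]bosonicE.
have f0 : f 0 = 0 by exact: linear_fun0.
have g0 : g 0 = 0 by exact: linear_fun0.
elim/big_rec: _ => [|u Q _ IHQ]; first by rewrite f0 g0.
by rewrite linf ling IHQ eq_fg.
Qed.

Lemma energy_bound_ptilde i e P : (0 < i)%N ->
  energy_bound e P -> energy_bound (e + i%:Z) (bvar C i * P).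
Proof.
move=> i_gt0; apply: energy_bound_map => [a Q S|u le_u].
  by rewrite mulrDr scalerAr.
rewrite bvarE of_monomM.
have := @energy_bound_of_monom (mulcm (ucm i.-1) u).
apply: energy_bound_le.
by rewrite energyM energy_ucm prednK // PoszD addrC lerD2r.
Qed.

Lemma modeb_linear n : linear (modeb n).
Proof.
by rewrite modeb.unlock; apply: scale_linear; exact: dptilde_linear.
Qed.

Lemma modeb0 P : modeb 0 P = 0.
Proof. by rewrite modeb.unlock; exact: scale0r. Qed.

Lemma modeb_of_monom n u :
  modeb n.+1 (mon u) = (n.+1%:R * (u n)%:R) *: mon (divcm u (ucm n)).
Proof.
rewrite modeb.unlock; have -> := dptilde_of_monom n.+1 u.
exact: scalerA.
Qed.

Lemma energy_bound_modeb i e P :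
  energy_bound e P -> energy_bound (e - i%:Z) (modeb i P).
Proof.
apply: energy_bound_map (modeb_linear i) _ => u le_u.
case: i => [|i]; first by rewrite modeb0; exact: energy_bound0.
rewrite modeb_of_monom; have [->|ui_neq0] := eqVneq (u i) 0%N.
  by rewrite mulr0 scale0r; exact: energy_bound0.
rewrite -[_ *: _]addr0; apply: energy_bound_linear; last exact: energy_bound0.
have := @energy_bound_of_monom (divcm u (ucm i)); apply: energy_bound_le.
have := energyM (divcm u (ucm i)) (ucm i).
by rewrite -monom_divM ?lt0n // energy_ucm; lia.
Qed.

Lemma modeb_der i P Q : modeb i (P * Q) = modeb i P * Q + P * modeb i Q.
Proof.
case: i => [|i]; first by rewrite !modeb0 mul0r mulr0 addr0.
have lin := leibniz_linear _ (modeb_linear i.+1).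
move: P; apply: bosonic_linear_ext => [||u].
- exact: (lin Q).1.
- exact: (lin Q).2.
rewrite mulrC addrC (mulrC _ Q) (mulrC (mon u)).
move: Q; apply: bosonic_linear_ext => [||v].
- exact: (lin (mon u)).1.
- exact: (lin (mon u)).2.
rewrite addrC (mulrC (mon v)) (mulrC _ (modeb i.+1 (mon u))).
rewrite (mulrC _ (mon u)).
rewrite of_monomM !modeb_of_monom -scalerAl -scalerAr !of_monomM.
rewrite (mulcmE u v); apply: scale_weights => ui_neq0; congr (mon _).
  apply/eqP/cmP => j; rewrite !(mulcmE, divcmE, ucmE).
  by case: eqP => [<-|_]; rewrite ?subn0 // addnC -addnBA ?lt0n // addnC.
apply/eqP/cmP => j; rewrite !(mulcmE, divcmE, ucmE).
by case: eqP => [<-|_]; rewrite ?subn0 // addnBA ?lt0n.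
Qed.

Lemma modeb_ptilde i j : (0 < j)%N ->
  modeb i (bvar C j) = ((i == j)%:R * i%:R)%:A.
Proof.
case: i j => [|i] [|j] // _; first by rewrite modeb0 mul0r scale0r.
rewrite bvarS modeb_of_monom.
have -> : (i.+1 == j.+1) = (i == j) by [].
have -> : (ucm j : monom) i = (i == j) :> nat by rewrite ucmE eq_sym.
have eq_mon : i = j -> mon (divcm (ucm j) (ucm i)) = 1.
  move=> ->; rewrite -of_monom1; congr (mon _); apply/eqP/cmP => l.
  by rewrite divcmE subnn onecmE.
case: (i =P j) => [eq_ij|_]; first by rewrite (eq_mon eq_ij) [_ * 1]mulrC.
have scale00 (c : C) (Q : V) : (0 * c) *: Q = 0.
  exact: etrans (congr1 ( *:%R ^~ _) (mul0r _)) (scale0r _).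
by rewrite [_ * 0]mulrC; exact: etrans (scale00 _ _) (esym (scale00 _ _)).
Qed.

Lemma modeb_comm i j P : modeb i (modeb j P) = modeb j (modeb i P).
Proof.
have m0 l : modeb l 0 = 0.
  exact: linear_fun0 (modeb_linear l).
have mZ l a S : modeb l (a *: S) = a *: modeb l S.
  exact: linear_funZ (modeb_linear l).
case: i => [|i]; first by rewrite !modeb0 m0.
case: j => [|j]; first by rewrite !modeb0 m0.
move: P; apply: bosonic_linear_ext => [a P S|a P S|u].
- by rewrite !modeb_linear.
- by rewrite !modeb_linear.
have [->//|ne_ij] := eqVneq i j.
rewrite !modeb_of_monom !mZ !modeb_of_monom.
have -> : divcm u (ucm j) i = u i :> nat.
  by rewrite divcmE ucmE eq_sym (negPf ne_ij) subn0.
have -> : divcm u (ucm i) j = u j :> nat.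
  by rewrite divcmE ucmE (negPf ne_ij) subn0.
apply: scale_comm; congr (mon _).
by apply/eqP/cmP => l; rewrite !divcmE subnAC.
Qed.

End Monomials.
End BosonicTheory.

(** * Evaluation of polynomials at a sequence of algebra elements *)

Module BosonicEvaluation.
Import finmap monalg BosonicTheory.

Section Coefficients.
Variable C : numClosedFieldType.
Local Notation mon := (bmon C).
Local Notation modeb := (@modeb C).

Lemma coef_modeb i w (P : bosonic C) :
  coef w (modeb i.+1 P) =
  i.+1%:R * (w i).+1%:R * coef (mulcm w (ucm i)) P.
Proof.
move: P; apply: (@bosonic_linear_ext C C^o) => [a P Q|a P Q|u].
- by rewrite (modeb_linear i.+1 a P Q) coef_linear.
- by rewrite coef_linear [LHS]mulrDr [X in X + _ = _]mulrCA.
rewrite modeb_of_monom -[_ *: _]addr0 coef_linear [coef w 0]mcoeff0 addr0.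
rewrite !coef_of_monom; have [ui0|ui_neq0] := eqVneq (u i) 0%N.
  have -> : (u == mulcm w (ucm i)) = false.
    by apply/eqP=> eq_u; move: ui0; rewrite eq_u mulcmE ucmE eqxx addn1.
  by rewrite ui0 (_ : 0%:R = 0) // mulr0 mul0r mulr0.
have -> : (divcm u (ucm i) == w) = (u == mulcm w (ucm i)).
  apply/eqP/eqP => [<-|->]; first by rewrite -monom_divM // lt0n.
  by apply/eqP/cmP => j; rewrite divcmE mulcmE addnK.
case: eqP => [->|_]; last by rewrite !mulr0.
by rewrite mulcmE ucmE eqxx addn1.
Qed.

(** A monomial other than 1 contains some variable, and its coefficient is recovered, up to a
    nonzero integer, from the derivative along that variable. *)
Lemma modeb_eq0 (P : bosonic C) : (forall i, modeb i.+1 P = 0) ->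
  P = coef (onecm nat) P *: 1.
Proof.
move=> bP0; apply: bosonicP => u.
rewrite -of_monom1 -[_ *: _]addr0 coef_linear [coef u 0]mcoeff0 addr0.
rewrite coef_of_monom; case: eqP => [->|ne_u]; first by rewrite mulr1.
have [i ui_gt0] : exists i, (0 < u i)%N.
  have [supp0|[i ui]] := fset_0Vmem (finsupp u); last first.
    by exists i; rewrite lt0n cmE_neq0.
  case: ne_u; apply/eqP; rewrite eq_sym; apply/cmP => i; rewrite onecmE.
  by apply/eqP; rewrite cmE_eq0 supp0.
have := coef_modeb i (divcm u (ucm i)) P; rewrite bP0 -monom_divM //.
rewrite mulr0 [coef _ 0]mcoeff0 => /esym/eqP; rewrite mulf_eq0.
move=> /orP[|/eqP //].
by rewrite mulf_eq0 !pnatr_eq0.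
Qed.

End Coefficients.

Section Evaluation.
Variables (C : numClosedFieldType) (A : comAlgType C) (N : nat) (s : nat -> A).
Local Notation V := (bosonic C).
Local Notation mon := (bmon C).
Local Notation modeb := (@modeb C).

Definition eval_monom (u : monom) : A := \prod_(i < N) s i.+1 ^+ u i.

(* Variables of index larger than N are sent to 1. *)
Definition eval (P : V) : A := \sum_(u <- msupp P) coef u P *: eval_monom u.

Lemma eval_linear : linear eval.
Proof.
have evalE (P : V) (d : {fset monom}) : (msupp P `<=` d)%fset ->
    eval P = \sum_(u <- d) coef u P *: eval_monom u.
  move=> sPd; apply: big_fset_incl => // u _ /mcoeff_outdom Pu0.
  by rewrite /coef Pu0 scale0r.
move=> a P Q; pose d := (msupp (a *: P + Q) `|` msupp P `|` msupp Q)%fset.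
rewrite !(evalE _ d) ?fsubsetUr //; last 2 first.
- by rewrite fsubsetU // fsubsetUr.
- by rewrite fsubsetU // fsubsetUl.
rewrite scaler_sumr -big_split /=; apply: eq_bigr => u _.
by rewrite coef_linear scalerDl scalerA.
Qed.

Lemma eval_bmon u : eval (mon u) = eval_monom u.
Proof.
rewrite /eval bmon.unlock msuppU1 big_seq_fset1 [coef _ _]mcoeffU1 eqxx.
exact: scale1r.
Qed.

Lemma eval_monomM u v : eval_monom (mulcm u v) = eval_monom u * eval_monom v.
Proof.
rewrite -big_split /=; apply: eq_bigr => i _.
by rewrite mulcmE exprD.
Qed.

Lemma eval_monom1 : eval_monom (onecm nat) = 1.
Proof. by apply: big1 => i _; rewrite onecmE. Qed.

Lemma evalM P Q : eval (P * Q) = eval P * eval Q.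
Proof.
move: P; apply: bosonic_linear_ext => [a P S|a P S|u].
- by rewrite mulrDl -scalerAl eval_linear.
- by rewrite eval_linear mulrDl -scalerAl.
move: Q; apply: bosonic_linear_ext => [a P S|a P S|v].
- by rewrite mulrDr -scalerAr eval_linear.
- by rewrite eval_linear mulrDr -scalerAr.
by rewrite of_monomM !eval_bmon eval_monomM.
Qed.

Lemma eval_bvar i : (0 < i <= N)%N -> eval (bvar C i) = s i.
Proof.
case: i => // i /= lt_iN; rewrite bvarS eval_bmon /eval_monom.
rewrite (bigD1 (Ordinal lt_iN)) //= ucmE eqxx expr1 big1 ?mulr1 // => j ne_j.
rewrite ucmE; case: eqP => // eq_ij; case/eqP: ne_j.
exact/val_inj.
Qed.

Lemma eval_bvar_out i : (N < i)%N -> eval (bvar C i) = 1.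
Proof.
case: i => // i; rewrite ltnS => le_Ni; rewrite bvarS eval_bmon.
apply: big1 => j _; rewrite ucmE gtn_eqF //.
exact: leq_trans (ltn_ord j) le_Ni.
Qed.

Lemma monom_ind (S : monom -> Prop) : S (onecm nat) ->
  (forall u i, S u -> S (mulcm u (ucm i))) -> forall u, S u.
Proof.
move=> S1 Smul u; have [n] := ubnP (energy u).
elim: n u => // n IHn u; rewrite ltnS => le_un.
have [supp0|[i ui]] := fset_0Vmem (finsupp u).
  rewrite (_ : u = onecm nat) //; apply/eqP/cmP => i.
  by rewrite onecmE; apply/eqP; rewrite cmE_eq0 supp0.
have ui_gt0 : (0 < u i)%N by rewrite lt0n cmE_neq0.
rewrite (monom_divM ui_gt0); apply: Smul; apply: IHn; apply: leq_trans le_un.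
rewrite [in X in (_ < X)%N](monom_divM ui_gt0) energyM energy_ucm addnS ltnS.
exact: leq_addr.
Qed.

(** The factors [l.+1%:R^-1] undo the weight built into [modeb]. The sum stops at N because later
    variables are evaluated at 1, which every derivation kills. *)
Lemma eval_chain_rule (D : A -> A) P : linear D ->
  (forall f g, D (f * g) = D f * g + f * D g) ->
  D (eval P) =
  \sum_(l < N) l.+1%:R^-1 *: (eval (modeb l.+1 P) * D (s l.+1)).
Proof.
move=> linD derD; move: P; apply: bosonic_linear_ext => [a P Q|a P Q|u].
- by rewrite eval_linear linD.
- rewrite scaler_sumr -big_split /=; apply: eq_bigr => l _.
  rewrite modeb_linear eval_linear mulrDl -scalerAl scalerDr !scalerA.
  by rewrite mulrC.
have D1 : D 1 = 0.
  have := derD 1 1; rewrite !mulr1 mul1r => eqD.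
  by apply: (addrI (D 1)); rewrite addr0 -eqD.
elim/monom_ind: u => [|u i IHu].
  rewrite eval_bmon eval_monom1 D1 big1 // => l _.
  rewrite modeb_of_monom onecmE (_ : 0%:R = 0) // mulr0.
  by rewrite (linear_funZ _ _ eval_linear) scale0r mul0r scaler0.
rewrite -of_monomM evalM derD IHu mulr_suml -bvarS.
have step (l : 'I_N) :
    l.+1%:R^-1 *: (eval (modeb l.+1 (mon u * bvar C i.+1)) * D (s l.+1)) =
    l.+1%:R^-1 *: (eval (modeb l.+1 (mon u)) * D (s l.+1)) * eval (bvar C i.+1)
    + (l == i :> nat)%:R *: (eval (mon u) * D (s l.+1)).
  rewrite modeb_der modeb_ptilde // eqSS.
  have -> : mon u * ((l == i :> nat)%:R * l.+1%:R)%:A =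
      ((l == i :> nat)%:R * l.+1%:R) *: mon u by exact: mulr_algr.
  rewrite addrC eval_linear evalM mulrDl scalerDr addrC -!scalerAl.
  congr (_ + _).
    by rewrite mulrAC.
  by rewrite scalerA mulrCA mulVf ?mulr1 // pnatr_eq0.
rewrite (eq_bigr _ (fun l _ => step l)) big_split /=; congr (_ + _).
have [lt_iN|le_Ni] := ltnP i N.
  rewrite (bigD1 (Ordinal lt_iN)) //= eqxx scale1r big1 ?addr0 => [|l].
    by rewrite eval_bvar.
  by rewrite -(inj_eq val_inj) /= => /negPf->; rewrite scale0r.
rewrite eval_bvar_out // D1 mulr0 big1 // => l _.
by rewrite ltn_eqF ?scale0r // (leq_trans (ltn_ord l)).
Qed.

End Evaluation.
End BosonicEvaluation.

(** * Laplacian of the Krylov determinant *)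

Section RowReplacement.
Variables (A : comNzRingType) (N : nat).
Implicit Types (f : 'I_N -> 'rV[A]_N) (r : 'I_N) (w : 'rV[A]_N).

Definition rdet f := \det (\matrix_(i < N) f i).

Definition upd f r w : 'I_N -> 'rV[A]_N := fun i => if i == r then w else f i.

Lemma eq_rdet f g : f =1 g -> rdet f = rdet g.
Proof.
by move=> eq_fg; congr (\det _); apply/matrixP => i j; rewrite !mxE eq_fg.
Qed.

Lemma upd_same f r w w' : upd (upd f r w) r w' =1 upd f r w'.
Proof. by move=> i; rewrite /upd; case: eqP. Qed.

Lemma upd_swap f r r' w w' : r != r' ->
  upd (upd f r w) r' w' =1 upd (upd f r' w') r w.
Proof.
move=> ne_r i; rewrite /upd; have [->|//] := eqVneq i r'.
by rewrite eq_sym (negPf ne_r).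
Qed.

Lemma upd_id f r : upd f r (f r) =1 f.
Proof. by move=> i; rewrite /upd; case: eqP => // ->. Qed.

Definition cof f r : 'cV[A]_N := col r (\adj (\matrix_(i < N) f i)).

Lemma rdet_upd f r w : rdet (upd f r w) = (w *m cof f r) 0 0.
Proof.
rewrite /rdet (expand_det_row _ r) mxE; apply: eq_bigr => j _.
rewrite !mxE /upd eqxx; congr (_ * _); rewrite /cofactor; congr (_ * \det _).
by apply/matrixP => i l; rewrite !mxE eq_sym (negPf (neq_lift _ _)).
Qed.

Lemma rdet_updD f r w w' :
  rdet (upd f r (w + w')) = rdet (upd f r w) + rdet (upd f r w').
Proof. by rewrite !rdet_upd mulmxDl mxE. Qed.

Lemma rdet_updZ f r a w : rdet (upd f r (a *: w)) = a * rdet (upd f r w).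
Proof. by rewrite !rdet_upd -scalemxAl mxE. Qed.

Lemma rdet_upd0 f r : rdet (upd f r 0) = 0.
Proof. by rewrite !rdet_upd mul0mx mxE. Qed.

Lemma rdet_upd_sum f r (I : Type) (s : seq I) (P : pred I) (w : I -> 'rV_N) :
  rdet (upd f r (\sum_(i <- s | P i) w i)) =
  \sum_(i <- s | P i) rdet (upd f r (w i)).
Proof.
exact: (big_morph (fun x => rdet (upd f r x)) (rdet_updD f r) (rdet_upd0 f r)).
Qed.

Lemma rdet_alternate f r r' : r != r' -> f r = f r' -> rdet f = 0.
Proof.
move=> ne_r eq_f; apply: (determinant_alternate ne_r) => j.
by rewrite !mxE eq_f.
Qed.

Lemma rdet_upd_dup f r r' : r != r' -> rdet (upd f r (f r')) = 0.
Proof.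
move=> ne_r; apply: (rdet_alternate ne_r).
by rewrite /upd eqxx eq_sym (negPf ne_r).
Qed.

(** Polarization of the vanishing of determinants with two equal rows, valid over any commutative
    ring. *)
Lemma rdet_upd_anti f r r' w w' : r != r' ->
  rdet (upd (upd f r w) r' w') = - rdet (upd (upd f r w') r' w).
Proof.
move=> ne_r; apply/eqP; rewrite -subr_eq0 opprK; apply/eqP.
have dup x : rdet (upd (upd f r x) r' x) = 0.
  apply: (rdet_alternate ne_r); rewrite /upd !eqxx.
  by rewrite (negPf ne_r).
have := dup (w + w'); rewrite rdet_updD.
rewrite !(eq_rdet (upd_swap _ _ _ ne_r)) !rdet_updD.
by rewrite -!(eq_rdet (upd_swap _ _ _ ne_r)) !dup addr0 add0r addrC.
Qed.

(* tr (M Y adj M) = tr Y det M *)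
Lemma sum_rdet_mul f (Y : 'M[A]_N) :
  \sum_r rdet (upd f r (f r *m Y)) = \tr Y * rdet f.
Proof.
set M := \matrix_(i < N) f i.
transitivity (\tr (M *m Y *m \adj M)); last first.
  by rewrite mxtrace_mulC mulmxA mul_adj_mx mul_scalar_mx mxtraceZ mulrC.
apply: eq_bigr => r _; rewrite rdet_upd !mxE; apply: eq_bigr => j _.
rewrite !mxE; congr (_ * _); apply: eq_bigr => l _.
by rewrite !mxE.
Qed.

End RowReplacement.

Section Derivations.
Variables (A : comNzRingType) (D : A -> A).
Hypothesis D_D : forall a b, D (a + b) = D a + D b.
Hypothesis D_M : forall a b, D (a * b) = D a * b + a * D b.

Lemma der0 : D 0 = 0.
Proof. by apply: (addrI (D 0)); rewrite addr0 -D_D addr0. Qed.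

Lemma der1 : D 1 = 0.
Proof.
by have := D_M 1 1; rewrite !mulr1 mul1r -{1}[D 1]addr0 => /addrI.
Qed.

Lemma derN a : D (- a) = - D a.
Proof. by apply: (addrI (D a)); rewrite -D_D !subrr der0. Qed.

Lemma der_sum (I : Type) (s : seq I) (P : pred I) (F : I -> A) :
  D (\sum_(i <- s | P i) F i) = \sum_(i <- s | P i) D (F i).
Proof. exact: (big_morph D D_D der0). Qed.

Lemma der_nat n : D n%:R = 0.
Proof. by elim: n => [|n IHn]; rewrite ?der0 // -natr1 D_D IHn der1 addr0. Qed.

Lemma der_exp a n : D (a ^+ n.+1) = n.+1%:R * a ^+ n * D a.
Proof.
elim: n => [|n IHn]; first by rewrite expr1 expr0 mulr1 mul1r.
rewrite [in LHS]exprS D_M IHn -(natr1 n.+1) exprS; set u := a ^+ n; ring.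
Qed.

Lemma der_prod (I : eqType) (s : seq I) (F : I -> A) : uniq s ->
  D (\prod_(i <- s) F i) =
  \sum_(j <- s) \prod_(i <- s) (if i == j then D (F i) else F i).
Proof.
elim: s => [|x s IHs] /=; first by rewrite !big_nil der1.
move=> /andP[x_s uniq_s]; rewrite !big_cons D_M IHs // eqxx; congr (_ * _ + _).
  apply: eq_big_seq => i i_s; case: eqP => // eq_ix.
  by rewrite -eq_ix i_s in x_s.
rewrite mulr_sumr; apply: eq_big_seq => j j_s; rewrite big_cons.
by case: eqP => // eq_xj; rewrite eq_xj j_s in x_s.
Qed.

Definition mxder m n (M : 'M[A]_(m, n)) := map_mx D M.

Lemma mxderM m n p (M : 'M[A]_(m, n)) (M' : 'M[A]_(n, p)) :
  mxder (M *m M') = mxder M *m M' + M *m mxder M'.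
Proof.
apply/matrixP => i j; rewrite !mxE der_sum -big_split /=.
by apply: eq_bigr => l _; rewrite D_M !mxE.
Qed.

Lemma mxderD m n (M M' : 'M[A]_(m, n)) : mxder (M + M') = mxder M + mxder M'.
Proof. by apply/matrixP => i j; rewrite !mxE D_D. Qed.

Lemma mxder0 m n : mxder (0 : 'M[A]_(m, n)) = 0.
Proof. by apply/matrixP => i j; rewrite !mxE der0. Qed.

Lemma mxder_sum m n (I : Type) (s : seq I) (P : pred I)
    (M : I -> 'M[A]_(m, n)) :
  mxder (\sum_(i <- s | P i) M i) = \sum_(i <- s | P i) mxder (M i).
Proof. exact: (big_morph _ (@mxderD m n) (@mxder0 m n)). Qed.

Lemma mxder_tr n (M : 'M[A]_n) : D (\tr M) = \tr (mxder M).
Proof. by rewrite der_sum; apply: eq_bigr => i _; rewrite mxE. Qed.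

Lemma mxder_delta m n i j : mxder (delta_mx i j : 'M[A]_(m, n)) = 0.
Proof. by apply/matrixP => a b; rewrite !mxE der_nat. Qed.

Lemma mxder_exp n (M : 'M[A]_n) e :
  mxder (M ^+ e) = \sum_(a < e) M ^+ a *m mxder M *m M ^+ (e.-1 - a).
Proof.
elim: e => [|e IHe].
  by rewrite big_ord0; apply/matrixP => i j; rewrite !mxE der_nat.
rewrite exprS mxderM IHe big_ord_recl mul1mx subn0; congr (_ + _).
rewrite mulmx_sumr; apply: eq_bigr => a _; rewrite !mulmxA -[M *m _]exprS /=.
by congr (_ *m _ ^+ _); case: a => a lt_ae; rewrite /= /bump /=; lia.
Qed.

Lemma der_rdet n (f : 'I_n -> 'rV[A]_n) :
  D (rdet f) = \sum_r rdet (upd f r (mxder (f r))).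
Proof.
rewrite /rdet /determinant der_sum exchange_big /=; apply: eq_bigr => s _.
rewrite D_M.
have sign0 (c : bool) : D ((-1) ^+ c) = 0 by case: c; rewrite ?derN der1 ?oppr0.
rewrite sign0 mul0r add0r der_prod ?index_enum_uniq // mulr_sumr.
apply: eq_bigr => r _; congr (_ * _); apply: eq_bigr => i _.
by rewrite !mxE /upd; case: eqP => // ->; rewrite mxE.
Qed.

End Derivations.

(** * Derivatives of traces and of the Krylov determinant *)

Section Krylov.
Variables (A : comNzRingType) (N : nat) (X : 'M[A]_N) (v : 'rV[A]_N).
Variable d : 'I_N -> 'I_N -> A -> A.
Hypothesis two_regular : forall a : A, a + a = 0 -> a = 0.
Hypothesis d_D : forall i j a b, d i j (a + b) = d i j a + d i j b.
Hypothesis d_M : forall i j a b, d i j (a * b) = d i j a * b + a * d i j b.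
Hypothesis d_X : forall i j, mxder (d i j) X = delta_mx i j.
Hypothesis d_v : forall i j, mxder (d i j) v = 0.

Definition krow r := v *m X ^+ r.
Definition krylov := rdet (fun r : 'I_N => krow r).
Definition ptrace a := \tr (X ^+ a).

Definition lap f := \sum_i \sum_j d i j (d j i f).
Definition gradprod f g := \sum_i \sum_j d i j f * d j i g.

Local Notation kf := (fun r : 'I_N => krow r).

Lemma krowM a b : krow a *m X ^+ b = krow (a + b).
Proof. by rewrite /krow exprD mulmxA. Qed.

Lemma gradprodC f g : gradprod f g = gradprod g f.
Proof.
rewrite /gradprod exchange_big; apply: eq_bigr => i _; apply: eq_bigr => j _.
exact: mulrC.
Qed.

Lemma gradprod_exp f g n :
  gradprod f (g ^+ n.+1) = n.+1%:R * g ^+ n * gradprod f g.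
Proof.
rewrite mulr_sumr; apply: eq_bigr => i _; rewrite mulr_sumr.
apply: eq_bigr => j _; rewrite (der_exp (d_M j i)).
exact: mulrCA.
Qed.

Lemma lapM f g : lap (f * g) = lap f * g + 2 * gradprod f g + f * lap g.
Proof.
have -> : 2 * gradprod f g = gradprod f g + gradprod g f.
  by rewrite gradprodC; ring.
rewrite !mulr_suml mulr_sumr -!big_split; apply: eq_bigr => i _ /=.
rewrite !mulr_suml mulr_sumr -!big_split; apply: eq_bigr => j _ /=.
by rewrite d_M d_D !d_M; ring.
Qed.

Lemma d_exp i j e : mxder (d i j) (X ^+ e) =
  \sum_(a < e) X ^+ a *m delta_mx i j *m X ^+ (e.-1 - a).
Proof.
rewrite (mxder_exp (d_D i j) (d_M i j)); apply: eq_bigr => a _.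
by rewrite d_X.
Qed.

Lemma d_krow i j e : mxder (d i j) (krow e) =
  \sum_(a < e) krow a *m delta_mx i j *m X ^+ (e.-1 - a).
Proof.
rewrite (mxderM (d_D i j) (d_M i j)) d_v mul0mx add0r d_exp mulmx_sumr.
by apply: eq_bigr => a _; rewrite !mulmxA.
Qed.

Lemma mul_delta_row (u : 'rV[A]_N) i j (B : 'M[A]_N) :
  u *m delta_mx i j *m B = u 0 i *: row j B.
Proof.
have -> : u *m delta_mx i j = u 0 i *: delta_mx 0 j.
  apply/rowP => l; rewrite !mxE (bigD1 i) //= big1 ?addr0 => [|i' ne_i].
    by rewrite !mxE !eqxx.
  by rewrite mxE (negPf ne_i) mulr0.
by rewrite -scalemxAl -rowE.
Qed.

(** Completeness of matrix units: the sum of [E_ij M E_ji] is tr M times the identity. *)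
Lemma sum_delta_delta (u : 'rV[A]_N) (M B : 'M[A]_N) :
  \sum_i \sum_j u *m delta_mx i j *m M *m delta_mx j i *m B =
  \tr M *: (u *m B).
Proof.
rewrite (mulmx_sum_row u B) scaler_sumr; apply: eq_bigr => i _.
rewrite scaler_suml; apply: eq_bigr => j _.
by rewrite !mul_delta_row !mxE scalerA mulrC.
Qed.

(** The sum of [E_ji] tensor [E_ij] is the flip of the two tensor factors, so [u] and [u'] exchange
    the matrices that follow them. *)
Lemma rdet_bilinear f r r' (u u' : 'rV[A]_N) (B B' : 'M[A]_N) : r != r' ->
  \sum_i \sum_j rdet (upd (upd f r (u *m delta_mx j i *m B)) r'
                          (u' *m delta_mx i j *m B')) =
  rdet (upd (upd f r (u' *m B)) r' (u *m B')).
Proof.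
move=> ne_r; have scal a b w w' :
    rdet (upd (upd f r (a *: w)) r' (b *: w')) =
    b * (a * rdet (upd (upd f r w) r' w')).
  rewrite rdet_updZ; congr (_ * _).
  by rewrite !(eq_rdet (upd_swap _ _ _ ne_r)) rdet_updZ.
rewrite (mulmx_sum_row u B') rdet_upd_sum exchange_big /=.
apply: eq_bigr => j _; rewrite rdet_updZ (eq_rdet (upd_swap _ _ _ ne_r)).
rewrite (mulmx_sum_row u' B) rdet_upd_sum mulr_sumr; apply: eq_bigr => i _.
rewrite !mul_delta_row scal rdet_updZ (eq_rdet (upd_swap _ _ _ ne_r)).
exact: mulrCA.
Qed.

Lemma rdet_upd2_sum f r r' m m' (w : 'I_m -> 'rV[A]_N)
    (w' : 'I_m' -> 'rV[A]_N) :
  r != r' -> rdet (upd (upd f r (\sum_a w a)) r' (\sum_c w' c)) =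
  \sum_a \sum_c rdet (upd (upd f r (w a)) r' (w' c)).
Proof.
move=> ne_r; rewrite (eq_rdet (upd_swap _ _ _ ne_r)) rdet_upd_sum.
apply: eq_bigr => a _.
by rewrite -(eq_rdet (upd_swap _ _ _ ne_r)) rdet_upd_sum.
Qed.

Lemma rdet_bilinear2 f r g r' (u u' : 'rV[A]_N) (B B' : 'M[A]_N) :
  \sum_i \sum_j rdet (upd f r (u *m delta_mx i j *m B)) *
                rdet (upd g r' (u' *m delta_mx j i *m B')) =
  rdet (upd f r (u' *m B)) * rdet (upd g r' (u *m B')).
Proof.
rewrite (mulmx_sum_row u B') rdet_upd_sum mulr_sumr.
apply: eq_bigr => i _; rewrite (mulmx_sum_row u' B) rdet_upd_sum mulr_suml.
apply: eq_bigr => j _; rewrite !mul_delta_row !rdet_updZ.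
by ring.
Qed.

Lemma krylov_upd_dup (r : 'I_N) x : (x < N)%N -> x != r ->
  rdet (upd kf r (krow x)) = 0.
Proof.
move=> lt_xN ne_xr; have ne_r : r != Ordinal lt_xN.
  by apply: contra ne_xr => /eqP ->.
exact: (rdet_upd_dup kf ne_r).
Qed.

Lemma krylov_upd2_dup (r r' : 'I_N) x w : r != r' -> (x < N)%N ->
  x != r -> x != r' -> rdet (upd (upd kf r (krow x)) r' w) = 0.
Proof.
move=> ne_r lt_xN ne_xr ne_xr'; have ne_r1 : r != Ordinal lt_xN.
  by apply: contra ne_xr => /eqP ->.
apply: (rdet_alternate ne_r1); rewrite /upd eqxx (negPf ne_r).
have /negPf-> : Ordinal lt_xN != r' by apply: contra ne_xr' => /eqP <-.
by rewrite eq_sym (negPf ne_r1).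
Qed.

(** Contracting two differentiated factors closes the powers of [X] between them into a trace; the
    row that remains has exponent at most r - 2. *)
Lemma lap_krow r : \sum_i \sum_j mxder (d i j) (mxder (d j i) (krow r)) =
  \sum_(a < r)
    (\sum_(c < a) ptrace (a.-1 - c) *: krow (c + (r.-1 - a))
     + \sum_(c < r.-1 - a) ptrace c *: krow (a + ((r.-1 - a).-1 - c))).
Proof.
transitivity (\sum_(a < r) \sum_i \sum_j (\sum_(c < a)
      krow c *m delta_mx i j *m X ^+ (a.-1 - c)
        *m delta_mx j i *m X ^+ (r.-1 - a)
    + \sum_(c < r.-1 - a)
      krow a *m delta_mx j i *m X ^+ c
        *m delta_mx i j *m X ^+ ((r.-1 - a).-1 - c))).
  rewrite [RHS]exchange_big; apply: eq_bigr => i _ /=.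
  rewrite [RHS]exchange_big; apply: eq_bigr => j _ /=.
  rewrite d_krow (mxder_sum (d_D i j)); apply: eq_bigr => a _.
  rewrite 2!(mxderM (d_D i j) (d_M i j)) (mxder_delta (d_D i j) (d_M i j)).
  rewrite mulmx0 addr0 d_krow d_exp !mulmx_suml mulmx_sumr; congr (_ + _).
  by apply: eq_bigr => c _; rewrite !mulmxA.
apply: eq_bigr => a _.
under eq_bigr => i _ do rewrite big_split /=.
rewrite big_split /=; congr (_ + _).
  under eq_bigr => i _ do rewrite exchange_big /=.
  rewrite exchange_big; apply: eq_bigr => c _.
  by rewrite sum_delta_delta krowM.
rewrite exchange_big /=; under eq_bigr => i _ do rewrite exchange_big /=.
rewrite exchange_big; apply: eq_bigr => c _.
by rewrite sum_delta_delta krowM.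
Qed.

(** Two derivatives on one row produce Krylov rows of smaller exponent, already present in the
    determinant. On distinct rows r, r' the flip produces exponents x, y with x + y = r + r' - 2. *)
Lemma lap_krylov : lap krylov = 0.
Proof.
have d_krylov i j :
    d j i krylov = \sum_r rdet (upd kf r (mxder (d j i) (krow r))).
  exact: (der_rdet (d_D j i) (d_M j i)).
have dd_krylov i j : d i j (d j i krylov) =
    \sum_r (rdet (upd kf r (mxder (d i j) (mxder (d j i) (krow r))))
      + \sum_(r' | r' != r) rdet (upd (upd kf r (mxder (d j i) (krow r))) r'
                                  (mxder (d i j) (krow r')))).
  rewrite d_krylov (der_sum (d_D i j)); apply: eq_bigr => r _.
  rewrite (der_rdet (d_D i j) (d_M i j)) (bigD1 r) //=; congr (_ + _).
    by rewrite (eq_rdet (upd_same _ _ _ _)) {2}/upd eqxx.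
  by apply: eq_bigr => r' ne_r; rewrite {3}/upd (negPf ne_r).
rewrite /lap; under eq_bigr => i _ do under eq_bigr => j _ do rewrite dd_krylov.
under eq_bigr => i _ do rewrite exchange_big /=.
rewrite exchange_big big1 // => r _.
under eq_bigr => i _ do rewrite big_split /=.
rewrite big_split /=.
under eq_bigr => i _ do rewrite -rdet_upd_sum.
rewrite -rdet_upd_sum lap_krow rdet_upd_sum big1 ?add0r => [|a _]; last first.
  rewrite rdet_updD !rdet_upd_sum !big1 ?addr0 // => c _;
    rewrite rdet_updZ krylov_upd_dup ?mulr0 //; case: c => c /= lt_c;
    case: a lt_c => a /= lt_ar lt_c;
    case: r lt_ar lt_c => r /= lt_rN lt_ar lt_c; lia.
under eq_bigr => i _ do rewrite exchange_big /=.
rewrite exchange_big big1 // => r'; rewrite eq_sym => ne_r.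
under eq_bigr => i _ do under eq_bigr => j _ do
  rewrite !d_krow (rdet_upd2_sum _ _ _ ne_r).
under eq_bigr => i _ do rewrite exchange_big /=.
rewrite exchange_big big1 // => a _.
under eq_bigr => i _ do rewrite exchange_big /=.
rewrite exchange_big big1 // => c _.
rewrite (rdet_bilinear _ _ _ _ _ ne_r) !krowM.
move: (ne_r); rewrite -(inj_eq val_inj) /= => ne_v.
case: a c (ltn_ord r) (ltn_ord r') => a lt_ar [c lt_cr] /= lt_rN lt_rN'.
set x := (c + _)%N; set y := (a + _)%N.
have eq_xy : (x + y + 2 = r + r')%N by rewrite /x /y; lia.
clearbody x y.
(* If x and y differ, one of them is below N and different from both r and r', hence repeats an
   untouched row: every other case contradicts x + y + 2 = r + r'. *)
have [<-|ne_xy] := eqVneq x y.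
  apply: (rdet_alternate ne_r); rewrite /upd !eqxx.
  by rewrite (negPf ne_r).
have [/andP[/andP[lt_x ne_x] ne_x']|out_x] :=
    boolP ((x < N) && (x != r) && (x != r'))%N.
  exact: krylov_upd2_dup.
have [/andP[/andP[lt_y ne_y] ne_y']|out_y] :=
    boolP ((y < N) && (y != r) && (y != r'))%N; last by lia.
by rewrite (eq_rdet (upd_swap _ _ _ ne_r)) krylov_upd2_dup // eq_sym.
Qed.

(** After the flip, row r of one determinant has exponent x and row r' of the other y, with x + y =
    r + r' - 2. Thus x < r or y < r', and that determinant has a repeated row. *)
Lemma gradprod_krylov : gradprod krylov krylov = 0.
Proof.
have d_krylov i j : d i j krylov =
    \sum_(r < N) \sum_(a < r) rdet (upd kf r
       (krow a *m delta_mx i j *m X ^+ (r.-1 - a))).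
  rewrite /krylov (der_rdet (d_D i j) (d_M i j)); apply: eq_bigr => r _.
  by rewrite d_krow rdet_upd_sum.
rewrite /gradprod.
under eq_bigr => i _ do under eq_bigr => j _ do
  (rewrite !d_krylov mulr_suml; under eq_bigr => r _ do
    (rewrite mulr_suml; under eq_bigr => a _ do
      (rewrite mulr_sumr; under eq_bigr => r' _ do rewrite mulr_sumr))).
under eq_bigr => i _ do rewrite exchange_big /=.
rewrite exchange_big big1 // => r _.
under eq_bigr => i _ do rewrite exchange_big /=.
rewrite exchange_big big1 // => a _.
under eq_bigr => i _ do rewrite exchange_big /=.
rewrite exchange_big big1 // => r' _.
under eq_bigr => i _ do rewrite exchange_big /=.
rewrite exchange_big big1 // => c _.
rewrite rdet_bilinear2 !krowM.
case: a c (ltn_ord r) (ltn_ord r') => a lt_ar [c lt_cr] /= lt_rN lt_rN'.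
set x := (c + _)%N; set y := (a + _)%N.
have eq_xy : (x + y + 2 = r + r')%N by rewrite /x /y; lia.
clearbody x y; have [lt_xr|le_rx] := ltnP x r.
  rewrite krylov_upd_dup ?mul0r //; last by rewrite ltn_eqF.
  exact: ltn_trans lt_xr lt_rN.
have lt_yr : (y < r')%N by lia.
rewrite [X in _ * X]krylov_upd_dup ?mulr0 //; last by rewrite ltn_eqF.
exact: ltn_trans lt_yr lt_rN'.
Qed.

Lemma lap_krylov_exp k : lap (krylov ^+ k) = 0.
Proof.
elim: k => [|[|k] IHk].
- by rewrite /lap big1 // => i _; rewrite big1 // => j _;
    rewrite (der1 (d_M j i)) (der0 (d_D i j)).
- by rewrite expr1 lap_krylov.
rewrite exprSr lapM IHk mul0r add0r lap_krylov mulr0 addr0.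
by rewrite gradprodC gradprod_exp gradprod_krylov !mulr0.
Qed.

Lemma d_ptrace i j n : d i j (ptrace n) = n%:R * (X ^+ n.-1) j i.
Proof.
rewrite /ptrace (mxder_tr (d_D i j)) d_exp raddf_sum /=.
transitivity (\sum_(a < n) (X ^+ n.-1) j i); last first.
  by rewrite sumr_const card_ord mulr_natl.
apply: eq_bigr => a _; rewrite -mulmxA mxtrace_mulC -mulmxA.
have -> : X ^+ (n.-1 - a) *m X ^+ a = X ^+ n.-1.
  by rewrite -[_ *m _]exprD subnK //; case: a => a /= lt_an; lia.
rewrite /mxtrace (bigD1 i) //= big1 ?addr0 => [|l ne_l].
  rewrite mxE (bigD1 j) //= big1 ?addr0 => [|m ne_m].
    by rewrite mxE !eqxx mul1r.
  by rewrite mxE (negPf ne_m) andbF mul0r.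
by rewrite mxE big1 // => m _; rewrite mxE (negPf ne_l) mul0r.
Qed.

Lemma gradprod_ptrace m n :
  gradprod (ptrace m) (ptrace n) = (m * n)%:R * ptrace (m + n - 2).
Proof.
have [/eqP|mn_gt0] := posnP (m * n).
  rewrite muln_eq0 => /orP[]/eqP->;
    rewrite ?mul0n ?muln0 mul0r /gradprod big1 // => i _;
    by rewrite big1 // => j _; rewrite !d_ptrace !(mul0r, mulr0).
have -> : (m + n - 2 = m.-1 + n.-1)%N by case: m n mn_gt0 => [|m] [|n]; lia.
rewrite /ptrace exprD natrM /mxtrace mulr_sumr [LHS]exchange_big.
apply: eq_bigr => j _; rewrite mxE mulr_sumr; apply: eq_bigr => i _.
by rewrite !d_ptrace; ring.
Qed.

Lemma lap_ptrace n :
  lap (ptrace n) = n%:R * \sum_(a < n.-1) ptrace a * ptrace (n - 2 - a).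
Proof.
transitivity (n%:R * \sum_i \sum_j mxder (d i j) (X ^+ n.-1) i j).
  rewrite /lap mulr_sumr; apply: eq_bigr => i _; rewrite mulr_sumr.
  by apply: eq_bigr => j _; rewrite d_ptrace d_M der_nat // mul0r add0r mxE.
congr (_ * _).
under eq_bigr => i _ do under eq_bigr => j _ do rewrite d_exp summxE.
under eq_bigr => i _ do rewrite exchange_big /=.
rewrite exchange_big; apply: eq_bigr => a _ /=.
rewrite /ptrace mulr_suml; apply: eq_bigr => i _; rewrite mulr_sumr.
apply: eq_bigr => j _.
rewrite (_ : n - 2 - a = n.-1.-1 - a)%N ?[LHS]mxE; last by rewrite subn2.
rewrite (bigD1 j) //= big1 ?addr0 => [|l ne_l].
  rewrite mxE (bigD1 i) //= big1 ?addr0 => [|l ne_l].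
    by rewrite mxE !eqxx mulr1.
  by rewrite mxE (negPf ne_l) mulr0.
by rewrite mxE big1 ?mul0r // => m _; rewrite mxE (negPf ne_l) andbF mulr0.
Qed.

(* 2 sum_r r K[r -> r + s]: the images of the pairs a + b = s of traces under
   the trace identity cancel in pairs, except when the larger row moves by s. *)
Lemma sum_krylov_shift s :
  2 * \sum_(r < N) r%:R * rdet (upd kf r (krow (r + s))) =
  (\sum_(a < s.+1) ptrace a * ptrace (s - a) - s.+1%:R * ptrace s) * krylov.
Proof.
pose G (r : 'I_N) x := rdet (upd kf r (krow x)).
pose F (r r' : 'I_N) x y := rdet (upd (upd kf r (krow x)) r' (krow y)).
have FC r r' x y : r != r' -> F r r' x y = F r' r y x.
  by move=> ne_r; exact: eq_rdet (upd_swap _ _ _ ne_r).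
have Fanti r r' x y : r != r' -> F r r' x y = - F r r' y x.
  exact: rdet_upd_anti.
have F_lt (r r' : 'I_N) : (r < r')%N ->
    \sum_(b < s.+1) F r r' (r + b)%N (r' + (s - b))%N = G r' (r' + s)%N.
  move=> lt_r; have ne_r : r != r' by rewrite -(inj_eq val_inj) /= ltn_eqF.
  pose e := (r' - r)%N.
  (* Here r + b lies strictly between r and r', so it repeats an untouched row. *)
  have F0 (b : nat) : (0 < b < e)%N -> F r r' (r + b)%N (r' + (s - b))%N = 0.
    move=> /andP[b_gt0 lt_be]; rewrite /e in lt_be.
    apply: krylov_upd2_dup => //.
    - by have := ltn_ord r'; lia.
    - by rewrite -[X in _ != X]addn0 eqn_add2l -lt0n.
    - by lia.
  rewrite -(big_mkord xpredT (fun b => F r r' (r + b)%N (r' + (s - b))%N)).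
  rewrite big_ltn // addn0 subn0.
  have -> : F r r' r (r' + s)%N = G r' (r' + s)%N.
    apply: eq_rdet => i; rewrite /upd; case: eqP => // _.
    by case: eqP => [->|].
  rewrite -[RHS]addr0; congr (_ + _).
  have [lt_se|le_es] := ltnP s e.
    rewrite big_nat big1 // => b /andP[b_gt0 lt_bs]; apply: F0.
    by rewrite b_gt0 (leq_trans lt_bs).
  have e_gt0 : (0 < e)%N by rewrite subn_gt0.
  rewrite (@big_cat_nat _ _ _ e) //=; last exact: leqW.
  rewrite big_nat big1 ?add0r => [|b /F0 //].
  (* The reflection of [b] to [e + s - b] exchanges the two exponents, so the sum equals its
     opposite. *)
  apply: two_regular; rewrite {1}big_nat_rev -big_split /= big_nat big1 //.
  move=> b /andP[le_eb lt_bs]; apply/eqP; rewrite addr_eq0 -Fanti //.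
  by apply/eqP; congr (F r r' _ _); rewrite /e in le_eb *; lia.
have F_sum (r r' : 'I_N) : r != r' ->
    \sum_(a < s.+1) F r r' (r + (s - a))%N (r' + a)%N =
    if (r < r')%N then G r' (r' + s)%N else G r (r + s)%N.
  move=> ne_r; have [lt_r|] := ltnP r r'.
    rewrite -(F_lt _ _ lt_r) (reindex_inj rev_ord_inj); apply: eq_bigr => a _.
    rewrite /= subSS; congr (F r r' (r + _)%N _); rewrite subKn //.
    by rewrite -ltnS.
  rewrite leq_eqVlt eq_sym (inj_eq val_inj) (negPf ne_r) /= => lt_r.
  rewrite -(F_lt _ _ lt_r); apply: eq_bigr => a _.
  exact: FC.
(* The trace identity applied twice. Both traces on one row give, summed over [a], the multiple of
   [ptrace s] that the statement subtracts; the rest is a sum over pairs of rows. *)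
have pp_sum (a : 'I_s.+1) : ptrace a * ptrace (s - a) * krylov =
    \sum_r (G r (r + s)%N
      + \sum_(r' | r' != r) F r r' (r + (s - a))%N (r' + a)%N).
  rewrite -mulrA /krylov /ptrace -(sum_rdet_mul kf (X ^+ (s - a))) mulr_sumr.
  apply: eq_bigr => r _; rewrite krowM -sum_rdet_mul (bigD1 r) //=.
  have le_as : (a <= s)%N by rewrite -ltnS.
  congr (_ + _).
    by rewrite (eq_rdet (upd_same _ _ _ _)) {2}/upd eqxx krowM -addnA subnK.
  by apply: eq_bigr => r' ne_r; rewrite {3}/upd (negPf ne_r) krowM.
rewrite mulrBl mulr_suml (eq_bigr _ (fun a _ => pp_sum a)) exchange_big /=.
under [X in _ = X - _]eq_bigr => r _ do
  rewrite big_split /= sumr_const card_ord.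
rewrite big_split /= sumrMnl -mulrA.
have -> : ptrace s * krylov = \sum_r G r (r + s)%N.
  rewrite /krylov /ptrace -sum_rdet_mul; apply: eq_bigr => r _.
  by rewrite krowM.
rewrite [s.+1%:R * _]mulr_natl addrAC subrr add0r.
under [RHS]eq_bigr => r _ do rewrite exchange_big /=.

(* A row r is the larger one in 2 r ordered pairs, which is the weight on the left side. *)
transitivity (\sum_(r < N) \sum_(r' < N | r' != r)
    if (r < r')%N then G r' (r' + s)%N else G r (r + s)%N); last first.
  apply: eq_bigr => r _; apply: eq_bigr => r' ne_r.
  by rewrite F_sum // eq_sym.
have count (r : 'I_N) (x : A) : \sum_(r' < N | (r' < r)%N) x = r%:R * x.
  rewrite (big_ord_narrow (ltnW (ltn_ord r))) sumr_const card_ord.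
  by rewrite mulr_natl.
transitivity (\sum_(r < N) (\sum_(r' < N | (r < r')%N) G r' (r' + s)%N
    + \sum_(r' < N | (r' < r)%N) G r (r + s)%N)).
  rewrite big_split /= (exchange_big_dep xpredT) //= mulr_natl mulr2n.
  by congr (_ + _); apply: eq_bigr => r _; rewrite count.
apply: eq_bigr => r _; rewrite [RHS](bigID (fun r' : 'I_N => (r < r')%N)) /=.
congr (_ + _); apply: eq_big => r'.
- by rewrite -(inj_eq val_inj) /=; case: ltngtP.
- by move=> ->.
- by rewrite -(inj_eq val_inj) /=; case: ltngtP.
- by move=> lt_r; rewrite ltnNge (ltnW lt_r).
Qed.

(** The derivative of the trace inserts a power of [X] in place of one of the r factors of row r;
    the resulting exponent does not depend on the place, whence the weight r. *)
Lemma gradprod_ptrace_krylov n :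
  gradprod (ptrace n) krylov =
  n%:R * \sum_(r < N) r%:R * rdet (upd kf r (krow (r + n - 2))).
Proof.
case: n => [|n].
  rewrite mul0r /gradprod big1 // => i _; rewrite big1 // => j _.
  by rewrite d_ptrace !mul0r.
transitivity (n.+1%:R * \sum_(r < N) \sum_(a < r) \sum_i \sum_j
    (X ^+ n) j i * rdet (upd kf r (krow a *m delta_mx j i *m X ^+ (r.-1 - a)))).
  rewrite /gradprod; under eq_bigr => i _ do under eq_bigr => j _ do
    rewrite d_ptrace -mulrA.
  under eq_bigr => i _ do rewrite -mulr_sumr.
  rewrite -mulr_sumr; congr (_ * _).
  under [RHS]eq_bigr => r _ do rewrite exchange_big /=.
  rewrite [RHS]exchange_big; apply: eq_bigr => i _ /=.
  under [RHS]eq_bigr => r _ do rewrite exchange_big /=.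
  rewrite [RHS]exchange_big; apply: eq_bigr => j _ /=.
  rewrite /krylov (der_rdet (d_D j i) (d_M j i)) mulr_sumr.
  by apply: eq_bigr => r _; rewrite d_krow rdet_upd_sum mulr_sumr.
congr (_ * _); apply: eq_bigr => r _.
transitivity (\sum_(a < r) rdet (upd kf r (krow (r + n.+1 - 2)))).
  apply: eq_bigr => a _.
  have -> : krow (r + n.+1 - 2) = krow a *m X ^+ n *m X ^+ (r.-1 - a).
    by rewrite !krowM; congr krow; case: a => a /= lt_ar; lia.
  rewrite (mulmx_sum_row _ (X ^+ (r.-1 - a))) rdet_upd_sum.
  apply: eq_bigr => i _; rewrite rdet_updZ mxE mulr_suml.
  apply: eq_bigr => j _; rewrite mul_delta_row rdet_updZ.
  by rewrite mulrA [_ * krow a _ _]mulrC.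
by rewrite sumr_const card_ord mulr_natl.
Qed.

(** A shift by -1, outside the range of [sum_krylov_shift]: row r becomes a copy of row r - 1. *)
Lemma gradprod_ptrace1_krylov : gradprod (ptrace 1) krylov = 0.
Proof.
rewrite gradprod_ptrace_krylov big1 ?mulr0 // => r _.
have [->|r_gt0] := posnP r; first by rewrite mul0r.
rewrite krylov_upd_dup ?mulr0 //; have := ltn_ord r; lia.
Qed.

(** Origin of k + 1: the quadratic sum occurs once in the Laplacian of the trace and k times in the
    gradient term, through [sum_krylov_shift] at s = n - 1. The linear term comes from the latter
    only. *)
Lemma lap_ptrace_krylov_exp n k :
  lap (ptrace n.+1) * krylov ^+ k + 2 * gradprod (ptrace n.+1) (krylov ^+ k) =
  n.+1%:R * (k.+1%:R * (\sum_(a < n) ptrace a * ptrace (n.-1 - a))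
             - (k * n)%:R * ptrace n.-1) * krylov ^+ k.
Proof.
have -> : lap (ptrace n.+1) =
    n.+1%:R * \sum_(a < n) ptrace a * ptrace (n.-1 - a).
  by rewrite lap_ptrace subSS subn1.
set S := \sum_(a < n) _.
have grad_k : 2 * gradprod (ptrace n.+1) (krylov ^+ k) =
    k%:R * n.+1%:R * (S - n%:R * ptrace n.-1) * krylov ^+ k.
  case: k => [|k].
    rewrite !mul0r /gradprod big1 ?mulr0 // => i _; rewrite big1 // => j _.
    by rewrite (der1 (d_M j i)) mulr0.
  rewrite gradprod_exp mulrCA; case: n @S => [|n] S.
    by rewrite gradprod_ptrace1_krylov /S big_ord0; ring.
  rewrite gradprod_ptrace_krylov (mulrCA 2).
  have shiftE (r : 'I_N) : (r + n.+2 - 2 = r + n)%N by lia.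
  under eq_bigr => r _ do rewrite shiftE.
  rewrite sum_krylov_shift exprS /S /=; ring.
by rewrite grad_k natrM -(natr1 k); ring.
Qed.

(** Cramer's rule: with row r replaced by the vanishing combination, only the term l = r survives
    alternation. *)
Lemma krow_independent (a : 'I_N -> A) r :
  \sum_(l < N) a l *: krow l = 0 -> a r * krylov = 0.
Proof.
move=> sum0; have := rdet_upd_sum kf r (index_enum _) xpredT
  (fun l => a l *: krow l).
rewrite sum0 rdet_upd0 => /esym.
rewrite (bigD1 r) //= rdet_updZ (eq_rdet (upd_id kf r)) big1 ?addr0 //.
move=> l ne_l.
rewrite rdet_updZ [X in _ * X](_ : _ = 0) ?mulr0 //.
by apply: (rdet_upd_dup kf); rewrite eq_sym.
Qed.

End Krylov.

(** * Fock space of the matrix model *)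

Module FockTheory.
Import mpoly.

HB.lock Definition dZ (C : numClosedFieldType) N (i j : 'I_N) (f : Fock C N) :
  Fock C N := mderiv (Zdag_idx i j) f.

Section FockTheory.
Variables (C : numClosedFieldType) (N : nat).
Local Notation A := (Fock C N).
Local Notation X := (Zdag_mx C N).
Local Notation v := (lamdag_row C N).
Local Notation dZ := (@dZ C N).

Lemma Z_opE i j : @Z_op C N i j =1 dZ j i.
Proof. by move=> f; rewrite dZ.unlock. Qed.

Lemma dZ_linear i j : linear (dZ i j).
Proof. by move=> a f g; rewrite dZ.unlock; rewrite mderivD mderivZ. Qed.

Lemma dZ_D i j f g : dZ i j (f + g) = dZ i j f + dZ i j g.
Proof. by rewrite dZ.unlock; exact: mderivD. Qed.

Lemma dZ_M i j f g : dZ i j (f * g) = dZ i j f * g + f * dZ i j g.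
Proof. by rewrite dZ.unlock; exact: mderivM. Qed.

Lemma dZ_comm i j k l f : dZ i j (dZ k l f) = dZ k l (dZ i j f).
Proof. by rewrite dZ.unlock; exact: mderiv_comm. Qed.

Lemma Zdag_idx_inj i j k l :
  (Zdag_idx i j == Zdag_idx k l :> 'I_(N * N + N)) = (i == k) && (j == l).
Proof.
rewrite (inj_eq (@lshift_inj _ _)) (inj_eq (@cast_ord_inj _ _ _)).
by rewrite (inj_eq enum_rank_inj) xpair_eqE.
Qed.

Lemma mderivX1 (a b : 'I_(N * N + N)) :
  mderiv a ('X_b : {mpoly C[N * N + N]}) = (b == a)%:R.
Proof.
rewrite mderivX mnm1E; case: eqP => [->|_]; last by rewrite scale0r.
have -> : (U_(a) - U_(a))%MM = 0%MM :> 'X_{1..N * N + N}.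
  by apply/mnmP => b'; rewrite mnmBE mnm0E subnn.
by rewrite mpolyX0 scale1r.
Qed.

Lemma dZ_X i j : mxder (dZ i j) X = delta_mx i j.
Proof.
apply/matrixP => a b; rewrite !mxE dZ.unlock; apply: etrans (mderivX1 _ _) _.
by rewrite Zdag_idx_inj.
Qed.

Lemma dZ_v i j : mxder (dZ i j) v = 0.
Proof.
apply/matrixP => a b; rewrite !mxE dZ.unlock; apply: etrans (mderivX1 _ _) _.
by rewrite /Zdag_idx /lamdag_idx eq_sym eq_lrshift.
Qed.

Lemma Fock_mulf_eq0 (f g : A) : f * g = 0 -> g != 0 -> f = 0.
Proof.
move=> fg0 g_neq0.
have /eqP : (f : {mpoly C[N * N + N]}) * (g : {mpoly C[N * N + N]}) = 0 by [].
by rewrite mulf_eq0 (negPf g_neq0) orbF => /eqP.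
Qed.

Lemma Fock_exp_neq0 (f : A) n : f != 0 -> f ^+ n != 0.
Proof. exact: (@expf_neq0 {mpoly C[N * N + N]} f n). Qed.

(* The determinant is 1 when Z^dagger is a shift and lambda^dagger the first
   basis vector. *)
Definition shift_point (a : 'I_(N * N + N)) : C :=
  match fintype.split a with
  | inl b => [exists i : 'I_N, exists j : 'I_N,
               (mxvec_index i j == b) && (j == i.+1 :> nat)]%:R
  | inr i => (i == 0 :> nat)%:R
  end.

Definition at_shift (f : A) : C := meval shift_point f.

Lemma krylov_neq0 : krylov X v != 0.
Proof.
apply/eqP => D0; have : at_shift (krylov X v) = 1; last first.
  by rewrite D0 /at_shift meval0 => /eqP; rewrite eq_sym oner_eq0.
pose ev : {rmorphism {mpoly C[N * N + N]} -> C} := meval shift_point.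
have ev_X l j : ev (X l j) = (j == l.+1 :> nat)%:R.
  rewrite mxE; apply: etrans (mevalXU _ _) _.
  rewrite /shift_point /Zdag_idx (unsplitK (inl (mxvec_index l j))).
  congr ((_ : bool)%:R); apply/existsP/idP => [[l' /existsP[j']]|eq_j].
    rewrite (inj_eq (@cast_ord_inj _ _ _)) (inj_eq enum_rank_inj) xpair_eqE.
    by move=> /andP[/andP[/eqP-> /eqP->]].
  by exists l; apply/existsP; exists j; rewrite eqxx.
have ev_v j : ev (v 0 j) = (j == 0 :> nat)%:R.
  rewrite mxE; apply: etrans (mevalXU _ _) _.
  by rewrite /shift_point /lamdag_idx (unsplitK (inr j)).
have ev_krow r j : (r < N)%N -> ev (krow X v r 0 j) = (j == r :> nat)%:R.
  elim: r j => [|r IHr] j lt_rN; first by rewrite /krow expr0 mulmx1.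
  have -> : krow X v r.+1 = krow X v r *m X by rewrite /krow exprSr mulmxA.
  rewrite mxE rmorph_sum (bigD1 (Ordinal (ltnW lt_rN))) //= big1 ?addr0.
    by rewrite rmorphM /= IHr ?(ltnW lt_rN) // eqxx mul1r ev_X.
  move=> l ne_l; rewrite rmorphM /= IHr ?(ltnW lt_rN) //.
  by rewrite -(inj_eq val_inj) /= in ne_l; rewrite (negPf ne_l) mul0r.
rewrite /krylov /rdet /at_shift -[meval _]/(ev : _ -> _).
rewrite -[LHS](det_map_mx ev) -[RHS](det1 C N); congr (\det _).
apply/matrixP => i j; rewrite mxE [Y in ev Y]mxE ev_krow // [RHS]mxE.
by rewrite (inj_eq val_inj) eq_sym.
Qed.

End FockTheory.
End FockTheory.

(** * Symmetrized words and the Laplacian *)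

Module WordTheory.
Import FockTheory.

Section WordTheory.
Variables (C : numClosedFieldType) (N : nat).
Local Notation A := (Fock C N).
Local Notation X := (Zdag_mx C N).
Local Notation dZ := (@dZ C N).

Lemma sum_tuple_cons (V : nmodType) n (F : seq bool -> V)
    (P : pred (seq bool)) :
  \sum_(w : n.+1.-tuple bool | P w) F w =
  \sum_(w : n.-tuple bool | P (true :: w)) F (true :: w)
  + \sum_(w : n.-tuple bool | P (false :: w)) F (false :: w).
Proof.
rewrite (reindex (fun p : bool * n.-tuple bool => [tuple of p.1 :: p.2])) /=.
  rewrite -(pair_big_dep xpredT (fun b (w : n.-tuple bool) => P (b :: w))
    (fun b w => F (b :: w))) /=.
  by rewrite big_bool.
exists (fun w => (thead w, [tuple of behead w])) => [[b w]|w] _ /=.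
  by congr (_, _); apply/val_inj.
by rewrite [in RHS](tuple_eta w); apply/val_inj.
Qed.

Definition word_sum len m (i j : 'I_N) (f : A) : A :=
  \sum_(w : len.-tuple bool | count_mem true w == m) word_op w i j f.

Lemma word_sum0 m i j f :
  word_sum 0 m i j f = if (m == 0%N) && (i == j) then f else 0.
Proof.
rewrite /word_sum; have [->|m_neq0] := eqVneq m 0%N; last first.
  by rewrite big1 // => w; rewrite tuple0 /= eq_sym (negPf m_neq0).
rewrite (big_pred1 [tuple]) //= => w.
by rewrite [w]tuple0.
Qed.

Lemma word_sumS len m i j f : word_sum len.+1 m i j f =
  (if m is m'.+1 then \sum_l dZ l i (word_sum len m' l j f) else 0)
  + \sum_l X i l * word_sum len m l j f.
Proof.
rewrite {1}/word_sum (@sum_tuple_cons _ len (fun w => word_op w i j f)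
  (fun w => count_mem true w == m)); congr (_ + _).
  case: m => [|m]; first by rewrite big1.
  rewrite exchange_big /=; apply: eq_bigr => l _.
  under eq_bigr => w _ do rewrite Z_opE.
  by rewrite /word_sum (der_sum (@dZ_D C N l i)).
rewrite exchange_big /=; apply: eq_bigr => l _.
by rewrite /word_sum mulr_sumr.
Qed.

Definition laplacian := lap dZ.

Lemma laplacian_linear : linear laplacian.
Proof.
move=> a f g; rewrite /laplacian /lap scaler_sumr -big_split /=.
apply: eq_bigr => i _; rewrite scaler_sumr -big_split /=.
by apply: eq_bigr => j _; rewrite !dZ_linear.
Qed.

Lemma laplacian_dZ i j f : laplacian (dZ i j f) = dZ i j (laplacian f).
Proof.
rewrite /laplacian /lap (der_sum (@dZ_D C N i j)); apply: eq_bigr => a _.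
rewrite (der_sum (@dZ_D C N i j)); apply: eq_bigr => b _.
by rewrite (dZ_comm i j a b) (dZ_comm i j b a).
Qed.

Lemma laplacian_X i j f :
  laplacian (X i j * f) = X i j * laplacian f + 2%:R *: dZ j i f.
Proof.
rewrite /laplacian (lapM (@dZ_D C N) (@dZ_M C N)).
have -> : lap dZ (X i j) = 0.
  rewrite /lap big1 // => a _; rewrite big1 // => b _.
  have := congr1 (fun M : 'M[A]_N => M i j) (dZ_X C b a).
  rewrite [LHS]mxE => ->.
  by rewrite mxE (der_nat (@dZ_D C N a b) (@dZ_M C N a b)).
have -> : gradprod dZ (X i j) f = dZ j i f.
  have dX a b : dZ a b (X i j) = ((i == a) && (j == b))%:R.
    have := congr1 (fun M : 'M[A]_N => M i j) (dZ_X C a b).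
    by rewrite [LHS]mxE => ->; rewrite mxE.
  rewrite /gradprod (bigD1 i) //= (bigD1 j) //= dX !eqxx mul1r.
  rewrite !big1 ?addr0 // => [a ne_a|b ne_b].
    by rewrite big1 // => b _; rewrite dX eq_sym (negPf ne_a) mul0r.
  by rewrite dX [j == b]eq_sym (negPf ne_b) andbF mul0r.
rewrite mul0r add0r addrC; congr (_ + _).
by rewrite scaler_nat mulr_natl.
Qed.

(** Each word with [m.+1] letters Z arises from [m.+1] words with m of them by changing one letter
    Zdag into 2 Z. *)
Lemma laplacian_word_sum len m i j f :
  laplacian (word_sum len m i j f) =
  word_sum len m i j (laplacian f) + (2 * m.+1%:R) *: word_sum len m.+1 i j f.
Proof.
have lap0 : laplacian 0 = 0.
  by have := laplacian_linear (-1) 0 0; rewrite !scaleN1r !addNr.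
have lapD g h : laplacian (g + h) = laplacian g + laplacian h.
  by have := laplacian_linear 1 g h; rewrite !scale1r.
have lap_sum := big_morph laplacian lapD lap0.
elim: len m i j f => [|len IHlen] m i j f.
  rewrite !word_sum0 scaler0 addr0.
  by case: ifP.
rewrite !word_sumS lapD !lap_sum.
under [Y in _ + Y = _]eq_bigr => l _ do
  rewrite laplacian_X IHlen mulrDr -scalerAr.
rewrite !big_split /= -!scaler_sumr scalerDr addrA.
set Sz := \sum_l dZ l i (word_sum len m l j f).
case: m @Sz => [|m] Sz.
  by rewrite lap0 !add0r mulr1 -addrA [_ *: _ + _]addrC addrA.
rewrite lap_sum; under [Y in Y + _ + _ = _]eq_bigr => l _ do
  rewrite laplacian_dZ IHlen addrC dZ_linear addrC.
rewrite big_split /= -scaler_sumr -/Sz.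
have -> : 2 * m.+2%:R = 2 * m.+1%:R + 2 :> C by rewrite -(natr1 m.+1); ring.
set c := 2 * m.+1%:R + 2; rewrite [c *: Sz]scalerDl -!addrA; congr (_ + _).
rewrite addrCA; congr (_ + _); congr (_ + _).
by rewrite addrC.
Qed.

Lemma word_sum_Zdag len i j f : word_sum len 0 i j f = (X ^+ len) i j * f.
Proof.
elim: len i => [|len IHlen] i.
  rewrite word_sum0 /= expr0 mxE.
  by case: eqP; rewrite ?mul1r ?mul0r.
rewrite word_sumS add0r exprS mxE mulr_suml; apply: eq_bigr => l _.
by rewrite IHlen mulrA.
Qed.

(* [laplacian, Zdag] = 2 Z, so that ad(laplacian) turns each letter Zdag of a
   word into 2 Z in turn. *)
Lemma dpow_trace len m f :
  dpow laplacian m (fun g => ptrace X len * g) f = \sum_i word_sum len m i i f.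
Proof.
elim: m f => [|m IHm] f.
  rewrite dpow0 /ptrace /mxtrace mulr_suml; apply: eq_bigr => i _.
  by rewrite word_sum_Zdag.
rewrite (dpowS laplacian_linear) /ad !IHm.
have lap0 : laplacian 0 = 0.
  by have := laplacian_linear (-1) 0 0; rewrite !scaleN1r !addNr.
have lapD g h : laplacian (g + h) = laplacian g + laplacian h.
  by have := laplacian_linear 1 g h; rewrite !scale1r.
rewrite (big_morph laplacian lapD lap0).
under eq_bigr => i _ do rewrite laplacian_word_sum.
rewrite big_split /= -scaler_sumr addrAC subrr add0r scalerA mulVf ?scale1r //.
by rewrite mulf_neq0 ?pnatr_eq0.
Qed.

Lemma tr_symE m n f : tr_sym m n f =
  ('C(m + n, m)%:R : C)^-1 *:
    dpow laplacian m (fun g => ptrace X (m + n) * g) f.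
Proof. by rewrite dpow_trace /tr_sym exchange_big. Qed.

End WordTheory.
End WordTheory.

(** * Intertwining of the Laplacian and the Hamiltonian *)

Section Intertwining.
Variables (C : numFieldType) (V A : comAlgType C) (k N : nat) (q : C).
Variables (x : nat -> V) (b : nat -> V -> V) (F : int -> V -> Prop).
Variable deg : V -> nat.
Variables (X : 'M[A]_N) (v : 'rV[A]_N) (d : 'I_N -> 'I_N -> A -> A).
Variable ev : V -> A.

Hypothesis b_linear : forall i, linear (b i).
Hypothesis b_zero : forall P, b 0 P = 0.
Hypothesis b_der : forall i P Q, b i (P * Q) = b i P * Q + P * b i Q.
Hypothesis b_x : forall i j, (0 < j)%N -> b i (x j) = ((i == j)%:R * i%:R)%:A.
Hypothesis b_comm : forall i j P, b i (b j P) = b j (b i P).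
Hypothesis F_linear : forall e a P Q, F e P -> F e Q -> F e (a *: P + Q).
Hypothesis F_0 : forall e, F e 0.
Hypothesis F_le : forall (e e' : int) P, e <= e' -> F e P -> F e' P.
Hypothesis F_neg : forall (e : int) P, e < 0 -> F e P -> P = 0.
Hypothesis F_deg : forall P, F (deg P) P.
Hypothesis F_x : forall i e P, (0 < i)%N -> F e P -> F (e + i%:Z) (x i * P).
Hypothesis F_b : forall i e P, F e P -> F (e - i%:Z) (b i P).
Hypothesis b_eq0 : forall P, (forall i, b i.+1 P = 0) -> exists c, P = c *: 1.

Hypothesis q2 : q ^+ 2 = k.+1%:R * N%:R.
Hypothesis N_gt0 : (0 < N)%N.
Hypothesis d_linear : forall i j, linear (d i j).
Hypothesis d_M : forall i j f g, d i j (f * g) = d i j f * g + f * d i j g.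
Hypothesis d_X : forall i j, mxder (d i j) X = delta_mx i j.
Hypothesis d_v : forall i j, mxder (d i j) v = 0.
Hypothesis krylov_regular : forall f, f * krylov X v = 0 -> f = 0.

Local Notation p := (ptrace X).
Local Notation G := (krylov X v ^+ k).
Local Notation lap := (lap d).
Local Notation gradprod := (gradprod d).

Definition hN (n : nat) : C := (k.+1%:R * n%:R)^-1.
Definition straces i := q ^- i *: p i.
Local Notation hamN := (ham k hN x b deg).

Hypothesis ev_linear : linear ev.
Hypothesis ev1 : ev 1 = 1.
Hypothesis evM : forall P Q, ev (P * Q) = ev P * ev Q.
Hypothesis ev_x : forall i, (0 < i <= N)%N -> ev (x i) = straces i.
Hypothesis chain_rule : forall i j P, d i j (ev P) =
  \sum_(l < N) l.+1%:R^-1 *: (ev (b l.+1 P) * d i j (straces l.+1)).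

Let q_neq0 : q != 0.
Proof. by rewrite -sqrf_eq0 q2 mulf_neq0 ?pnatr_eq0 // -lt0n. Qed.

Let hN_q : hN N = q ^- 2. Proof. by rewrite /hN -q2. Qed.

Let d_D i j f g : d i j (f + g) = d i j f + d i j g.
Proof. by have := d_linear i j 1 f g; rewrite !scale1r. Qed.

Let d_Z i j c a : d i j (c *: a) = c *: d i j a.
Proof. exact: linear_funZ (d_linear i j). Qed.

Let two_regular (a : A) : a + a = 0 -> a = 0.
Proof.
move=> aa0; have : (2 : C) *: a = 0 by rewrite scaler_nat mulr2n.
move/(congr1 (fun f => (2^-1 : C) *: f)).
by rewrite scalerA mulVf ?pnatr_eq0 // scale1r scaler0.
Qed.

Let lapZ c f : lap (c *: f) = c *: lap f.
Proof.
rewrite scaler_sumr; apply: eq_bigr => i _; rewrite scaler_sumr.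
by apply: eq_bigr => j _; rewrite !d_Z.
Qed.

Let gradprodZ c f g : gradprod (c *: f) g = c *: gradprod f g.
Proof.
rewrite scaler_sumr; apply: eq_bigr => i _; rewrite scaler_sumr.
by apply: eq_bigr => j _; rewrite d_Z scalerAl.
Qed.

Let evZ c P : ev (c *: P) = c *: ev P.
Proof. exact: linear_funZ ev_linear. Qed.

Let evD P Q : ev (P + Q) = ev P + ev Q.
Proof. by have := ev_linear 1 P Q; rewrite !scale1r. Qed.

Let ev0 : ev 0 = 0. Proof. exact: linear_fun0 ev_linear. Qed.

Let ev_sum (I : Type) (r : seq I) (S : I -> V) :
  ev (\sum_(i <- r) S i) = \sum_(i <- r) ev (S i).
Proof. exact: (big_morph ev evD ev0). Qed.

Lemma ev_power_sum i : (i <= N)%N -> ev (power_sum x N i) = straces i.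
Proof.
case: i => [|i] le_iN; last by rewrite ev_x.
by rewrite evZ ev1 /straces expr0 invr1 scale1r /ptrace mxtrace1 scaler_nat.
Qed.

(** The right side of [lap_ptrace_krylov_exp] has degree lower by two in [X], so the rescaling
    leaves [q ^- 2], which is [hN N]. *)
Lemma lap_straces l : (l < N)%N ->
  lap (straces l.+1) * G + 2 * gradprod (straces l.+1) G =
  (hN N * l.+1%:R) *: (ev (drift k x N l) * G).
Proof.
move=> lt_lN; rewrite lapZ gradprodZ -scalerAl -scalerAr -scalerDr.
rewrite (lap_ptrace_krylov_exp two_regular d_D d_M d_X d_v).
rewrite /drift -[- (_ *: _)]scaleN1r evD !evZ ev_sum.
under [in RHS]eq_bigr => a _.
  rewrite evM !ev_power_sum; last 2 first.
  - by case: a => a /= lt_al; lia.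
  - by case: a => a /= lt_al; lia.
  over.
case: l lt_lN => [|l] lt_lN.
  have zero (R : pzRingType) : 0%:R = 0 :> R by [].
  rewrite !big_ord0 muln0 !zero.
  by rewrite !(mul0r, mulr0, scale0r, scaler0, subr0, addr0).
rewrite ev_power_sum 1?ltnW //=.
have -> : \sum_(a < l.+1) straces a * straces (l - a) =
    q ^- l *: \sum_(a < l.+1) p a * p (l - a).
  rewrite scaler_sumr; apply: eq_bigr => a _.
  rewrite -scalerAl -scalerAr scalerA -invfM -exprD addnC subnK //.
  by rewrite -ltnS.
rewrite /straces; set S := \sum_(a < l.+1) _; move: S (p l) => S P.
rewrite hN_q !mulr_natl -!scaler_nat scaleN1r.
have -> : q ^- l.+2 = q ^- 2 * q ^- l by rewrite -invfM -exprD.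
  have -> : k.+1%:R *: (q ^- l *: S) - (k * l.+1)%:R *: (q ^- l *: P) =
      q ^- l *: (k.+1%:R *: S - (k * l.+1)%:R *: P).
    by rewrite scalerBr !scalerA ![_ / _]mulrC.
  by rewrite -!scalerAl !scalerA mulrAC.
exact: ltnW.
Qed.

Lemma gradprod_straces l m : (l + m <= N)%N ->
  gradprod (straces l.+1) (straces m.+1) =
  (hN N * (l.+1 * m.+1)%:R) *: ev (power_sum x N (l + m)).
Proof.
move=> le_lmN; rewrite ev_power_sum // gradprodZ gradprodC gradprodZ.
rewrite gradprodC (gradprod_ptrace d_D d_M d_X).
have -> : (l.+1 + m.+1 - 2 = l + m)%N by lia.
rewrite mulr_natl -scaler_nat !scalerA hN_q; congr (_ *: _).
have -> : q ^- l.+1 * q ^- m.+1 = q ^- 2 * q ^- (l + m).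
  by rewrite -!invfM -!exprD; congr (q ^- _); lia.
by rewrite mulrAC.
Qed.

Let gradprod_ev P f : gradprod (ev P) f =
  \sum_(l < N) l.+1%:R^-1 *: (ev (b l.+1 P) * gradprod (straces l.+1) f).
Proof.
transitivity (\sum_i \sum_j \sum_(l < N)
    l.+1%:R^-1 *: (ev (b l.+1 P) * (d i j (straces l.+1) * d j i f))).
  apply: eq_bigr => i _; apply: eq_bigr => j _.
  rewrite chain_rule mulr_suml; apply: eq_bigr => l _.
  by rewrite -scalerAl mulrA.
under eq_bigr => i _ do rewrite exchange_big /=.
rewrite exchange_big; apply: eq_bigr => l _ /=.
under eq_bigr => i _ do rewrite -scaler_sumr -mulr_sumr.
by rewrite -scaler_sumr -mulr_sumr.
Qed.

Let lap_ev P : lap (ev P) = \sum_(l < N) l.+1%:R^-1 *: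
  (ev (b l.+1 P) * lap (straces l.+1)
   + gradprod (ev (b l.+1 P)) (straces l.+1)).
Proof.
transitivity (\sum_i \sum_j \sum_(l < N) l.+1%:R^-1 *:
    (ev (b l.+1 P) * d i j (d j i (straces l.+1))
     + d i j (ev (b l.+1 P)) * d j i (straces l.+1))).
  apply: eq_bigr => i _; apply: eq_bigr => j _.
  rewrite chain_rule (der_sum (d_D i j)); apply: eq_bigr => l _.
  by rewrite d_Z d_M addrC.
under eq_bigr => i _ do rewrite exchange_big /=.
rewrite exchange_big; apply: eq_bigr => l _ /=.
under eq_bigr => i _ do rewrite -scaler_sumr big_split /= -mulr_sumr.
by rewrite -scaler_sumr big_split /= -mulr_sumr.
Qed.

(** By the chain rule, the harmonic power [G] leaves a first-order part, given by [lap_straces], and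
    a second-order part, given by [gradprod_straces]. *)
Lemma lap_ev_ground P : F N P -> lap (ev P * G) = ev (hamN N P) * G.
Proof.
move=> FP; have hamPE : hamN N P = ham_upto k hN x b N N P.
  exact: (hamE k hN x b_linear b_comm F_neg F_deg F_b).
rewrite hamPE /ham_upto evZ evD !ev_sum.
rewrite (lapM d_D d_M) (lap_krylov_exp d_D d_M d_X d_v) mulr0 addr0.
rewrite lap_ev gradprod_ev mulr_suml mulr_sumr -big_split /=.
rewrite -[RHS]scalerAl -big_split /= mulr_suml scaler_sumr.
apply: eq_bigr => l _.
have c_neq0 n : n.+1%:R != 0 :> C by rewrite pnatr_eq0.
transitivity (l.+1%:R^-1 *: (ev (b l.+1 P) *
    (lap (straces l.+1) * G + 2 * gradprod (straces l.+1) G))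
  + l.+1%:R^-1 *: (gradprod (ev (b l.+1 P)) (straces l.+1) * G)).
  rewrite -scalerAl -scalerAr -!scalerDr; congr (_ *: _).
  by ring.
rewrite lap_straces // -scalerAr scalerA mulrDl scalerDr; congr (_ + _).
  rewrite mulrCA mulVf // mulr1 evM; congr (_ *: _).
  by ring.
rewrite gradprod_ev ev_sum !mulr_suml !scaler_sumr; apply: eq_bigr => m _.
rewrite evM -scalerAl scalerA.
have [le_lmN|lt_Nlm] := leqP (l + m) N.
  rewrite addnC gradprod_straces 1?addnC // b_comm -scalerAr -scalerAl.
  rewrite scalerA natrM; congr (_ *: _).
    by field; rewrite !nat1r !pnatr_eq0.
  by rewrite addnC; ring.
(* Beyond index N the variables no longer evaluate to traces; there two derivatives lower the
   energy, at most N, below zero. *)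
have bb0 : b m.+1 (b l.+1 P) = 0.
  by apply: (F_neg _ (F_b m.+1 (F_b l.+1 FP))); lia.
have bb0' : b l.+1 (b m.+1 P) = 0 by rewrite b_comm.
by rewrite ?bb0 ?bb0' ev0 !(mul0r, mulr0, scaler0).
Qed.

Local Notation trm := (trmul (fun i P => x i * P)).

Let lap_linear : linear lap.
Proof.
move=> a f g; rewrite scaler_sumr -big_split /=; apply: eq_bigr => i _.
rewrite scaler_sumr -big_split /=; apply: eq_bigr => j _.
by rewrite !d_linear.
Qed.

(** The condition on [E + L] keeps every intermediate polynomial within energy N, where
    [lap_ev_ground] applies. *)
Theorem ev_dpow m L (E : nat) P : (E + L <= N)%N -> F E P ->
  ev (dpow (hamN N) m (trm N L) P) * G =
  q ^- L *: dpow lap m (fun f => p L * f) (ev P * G).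
Proof.
elim: m E P => [|m IHm] E P le_EN FP.
  rewrite !dpow0; have -> : trm N L P = power_sum x N L * P.
    by case: (L) => //=; rewrite mulr_algl.
  rewrite evM ev_power_sum ?(leq_trans (leq_addl _ _) le_EN) //.
  by rewrite -mulrA -scalerAl.
have F_to_N e Q : (e <= N)%N -> F e Q -> F N Q.
  by move=> le_eN; apply: F_le; rewrite lez_nat.
have FTP : F E (hamN N P).
  by apply: F_le (F_ham k hN deg F_linear F_0 F_le F_x F_b N FP); lia.
have FQ : F N (dpow (hamN N) m (trm N L) P).
  have := F_dpow k hN b_linear b_comm F_linear F_0 F_le F_neg F_deg F_x F_b
    N m L FP.
  by apply: F_le; lia.
have FPN : F N P by apply: F_to_N FP; exact: leq_trans (leq_addr _ _) le_EN.
rewrite !dpowS //; last first.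
  exact: (ham_linear k hN x b_linear b_comm F_linear F_le F_neg F_deg F_b).
rewrite evZ -scalerAl /ad; have evB Q Q' : ev (Q - Q') = ev Q - ev Q'.
  by rewrite -scaleN1r evD evZ scaleN1r.
rewrite evB mulrBl -lap_ev_ground // (IHm E) // (IHm E) // -lap_ev_ground //.
by rewrite (linear_funZ _ _ lap_linear) -scalerBr !scalerA mulrC.
Qed.

(** Differentiating [ev P = 0] along all entries of [X] gives a linear relation between powers of
    [X]. Applied to [v] it relates the Krylov rows, so all derivatives of [P] evaluate to 0, and
    they have smaller energy. *)
Lemma ev_injective (E : nat) P : (E <= N)%N -> F E P -> ev P = 0 -> P = 0.
Proof.
elim/ltn_ind: E P => E IHE P le_EN FP evP0.
have a0 (l : 'I_N) : ev (b l.+1 P) = 0.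
  pose a (l : 'I_N) := q ^- l.+1 *: ev (b l.+1 P).
  have sum_a i j : \sum_(l < N) a l * (X ^+ l) j i = 0.
    rewrite -[RHS](der0 (d_D i j)) -[in RHS]evP0 chain_rule.
    apply: eq_bigr => {}l _; rewrite d_Z (d_ptrace d_D d_M d_X).
    rewrite mulr_natl -scaler_nat /a -scalerAl -!scalerAr !scalerA.
    by congr (_ *: _); rewrite mulrCA mulVf ?mulr1 ?pnatr_eq0.
  have krow0 : \sum_(l < N) a l *: krow X v l = 0.
    apply/rowP => i; rewrite summxE mxE.
    transitivity (\sum_j v 0 j * \sum_(l < N) a l * (X ^+ l) j i); last first.
      by apply: big1 => j _; rewrite sum_a mulr0.
    under [RHS]eq_bigr => j _ do rewrite mulr_sumr.
    rewrite exchange_big; apply: eq_bigr => {}l _ /=.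
    by rewrite !mxE mulr_sumr; apply: eq_bigr => j _; rewrite mulrCA.
  have := krylov_regular (krow_independent l krow0).
  move/(congr1 (fun f => q ^+ l.+1 *: f)).
  by rewrite /a scalerA mulfV ?expf_neq0 // scale1r scaler0.
have bP0 i : b i.+1 P = 0.
  have [le_Ei|lt_iE] := leqP E i.
    by apply: (F_neg _ (F_b i.+1 FP)); lia.
  have lt_iN := leq_trans lt_iE le_EN.
  apply: (IHE (E - i.+1)%N) => //; first by lia.
  - by lia.
  - by have := F_b i.+1 FP; apply: F_le; lia.
  - exact: (a0 (Ordinal lt_iN)).
have [c eq_P] := b_eq0 bP0; move: evP0; rewrite eq_P evZ ev1.
have [->|c_neq0] := eqVneq c 0; first by rewrite !scale0r.
move/(congr1 (fun f => c^-1 *: f)); rewrite scalerA mulVf // scale1r scaler0.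
by move=> one0; have := oner_neq0 A; rewrite one0 eqxx.
Qed.

End Intertwining.

Lemma tends_unscale (C : numFieldType) (V : lmodType C) (h : nat -> C)
    (c s s' : C) (y : nat -> V) (u P : V) : c != 0 ->
  tends h (fun N => y N - (N%:R * (false%:R * s)) *: P)
    (c *: u + (false%:R * s') *: P) ->
  tends h (fun N => (h N ^+ false / c) *: y N) u.
Proof.
have zero : false%:R = 0 :> C by [].
move=> c_neq0 /(tendsZ c^-1).
rewrite zero !mul0r scale0r addr0 scalerA mulVf // scale1r.
apply: tends_ext => N _.
by rewrite mulr0 scale0r subr0 expr0 mul1r.
Qed.

(** The diagonal case: the extra factor [h N], from the term 2 delta in the exponent of the
    rescaling, cancels the divergence and leaves only its scalar. *)
Lemma tends_rescale (C : numFieldType) (V : lmodType C) (h : nat -> C)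
    (c s kappa : C) (y : nat -> V) (u P : V) :
  (forall N, (0 < N)%N -> h N * N%:R = kappa^-1) ->
  tends h (fun N => y N - (N%:R * s) *: P) u ->
  tends h (fun N => (h N ^+ true / c) *: y N) ((c^-1 * (s / kappa)) *: P).
Proof.
move=> hE /tends_small lim0.
have := tendsZ c^-1 (tendsD lim0 (tends_cst h ((s / kappa) *: P))).
rewrite add0r scalerA; apply: tends_ext => N /hE hNE.
rewrite scalerBr (scalerA (h N)) mulrA hNE [_ * s]mulrC subrK scalerA expr1.
by rewrite mulrC.
Qed.

(** * The rescaled operators on the states of the matrix model *)

Section MatrixModelStates.
Import BosonicTheory BosonicEvaluation FockTheory WordTheory.
Variables (C : numClosedFieldType) (k : nat).
Local Notation V := (bosonic C).
Local Notation X N := (Zdag_mx C N).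
Local Notation krylov N := (krylov (X N) (lamdag_row C N)).
Local Notation q N := (sqrt_kN C N k).

Definition bham := ham k (hN C k) (bvar C) (@modeb C) (@max_energy C).
Definition btrmul := trmul (fun i (P : V) => bvar C i * P).

Lemma sqrt_kN2 N : q N ^+ 2 = k.+1%:R * N%:R.
Proof. by rewrite /sqrt_kN sqrtCK natrM. Qed.

Definition eval_traces N : V -> Fock C N := eval N (scaled_trace C N k).

Lemma eval_traces_linear N : linear (eval_traces N).
Proof. exact: eval_linear. Qed.

Lemma eval_traces1 N : eval_traces N 1 = 1.
Proof. by rewrite -of_monom1 /eval_traces eval_bmon eval_monom1. Qed.

Lemma eval_tracesM N P Q :
  eval_traces N (P * Q) = eval_traces N P * eval_traces N Q.
Proof. exact: evalM. Qed.

Lemma eval_traces_bvar N i : (0 < i <= N)%N ->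
  eval_traces N (bvar C i) = straces (q N) (X N) i.
Proof. by move=> i_le; rewrite /eval_traces eval_bvar. Qed.

Lemma eval_traces_chain_rule N i j P : dZ i j (eval_traces N P) =
  \sum_(l < N) l.+1%:R^-1 *: (eval_traces N (modeb l.+1 P) *
    dZ i j (straces (q N) (X N) l.+1)).
Proof.
by apply: eval_chain_rule; [exact: dZ_linear|exact: dZ_M].
Qed.

Lemma stateE N P : state k N P = eval_traces N P * krylov N ^+ k.
Proof.
rewrite /state /eval_traces /eval mulr_suml; apply: eq_bigr => u _.
by rewrite -scalerAl.
Qed.

Lemma state_linear N : linear (state k N : V -> Fock C N).
Proof.
move=> a P Q; rewrite !stateE.
by rewrite eval_traces_linear mulrDl -scalerAl.
Qed.

Lemma state_dpow N m L (E : nat) (P : V) :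
    (0 < N)%N -> (E + L <= N)%N -> energy_bound E P ->
  state k N (dpow (bham N) m (btrmul N L) P) =
  q N ^- L *:
    dpow (@laplacian C N) m (fun f => ptrace (X N) L * f) (state k N P).
Proof.
move=> N_gt0 le_EN bP; rewrite !stateE.
exact: (ev_dpow (@modeb_linear C) (@modeb_comm C) (@energy_bound_linear C)
  (@energy_bound0 C) (@energy_bound_le C) (@energy_bound_neg C)
  (@energy_bound_max C) (@energy_bound_ptilde C) (@energy_bound_modeb C)
  (sqrt_kN2 N) N_gt0 (@dZ_linear C N) (@dZ_M C N) (@dZ_X C N) (@dZ_v C N)
  (@eval_traces_linear N) (eval_traces1 N) (@eval_tracesM N)
  (@eval_traces_bvar N) (@eval_traces_chain_rule N) m le_EN bP).
Qed.

Lemma state_injective N (E : nat) : (0 < N)%N -> (E <= N)%N ->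
  {in energy_le C E &, injective (state k N : V -> Fock C N)}.
Proof.
move=> N_gt0 le_EN P Q /energy_leP bP /energy_leP bQ eq_PQ.
have bPQ : energy_bound E (-1 *: Q + P) by exact: energy_bound_linear.
have krylov_regular (f : Fock C N) : f * krylov N = 0 -> f = 0.
  by move/Fock_mulf_eq0; apply; exact: krylov_neq0.
have ev0 : eval_traces N (-1 *: Q + P) = 0.
  apply: (@Fock_mulf_eq0 C N _ (krylov N ^+ k)).
    by rewrite -stateE state_linear eq_PQ scaleN1r addNr.
  by apply: Fock_exp_neq0; exact: krylov_neq0.
have := ev_injective (@energy_bound_le C) (@energy_bound_neg C)
  (@energy_bound_modeb C) (fun P H => ex_intro _ _ (@modeb_eq0 C P H))
  (sqrt_kN2 N) N_gt0 (@dZ_linear C N) (@dZ_M C N) (@dZ_X C N) krylov_regular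
  (@eval_traces_linear N) (eval_traces1 N) (@eval_traces_chain_rule N)
  le_EN bPQ ev0.
by rewrite scaleN1r addrC => /subr0_eq.
Qed.

(* t_scaled k m n read on the polynomials *)
Definition poly_op m n N (P : V) : V :=
  (hN C k N ^+ (m == n) / 'C(m + n, m)%:R) *:
    dpow (bham N) m (btrmul N (m + n)) P.

Lemma t_scaled_state m n N (E : nat) P :
    (0 < N)%N -> (E + (m + n) <= N)%N -> energy_bound E P ->
  t_scaled k m n (state k N P) = state k N (poly_op m n N P).
Proof.
move=> N_gt0 le_EN bP; rewrite /t_scaled tr_symE.
rewrite /poly_op (linear_funZ _ _ (@state_linear N)).
rewrite (state_dpow m N_gt0 le_EN bP).
rewrite [LHS]scalerA [RHS]scalerA; congr (_ *: _).
have -> : hN C k N = q N ^- 2 by rewrite /hN sqrt_kN2.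
by rewrite exprD invfM -exprVn exprM -!exprVn; ring.
Qed.

Lemma energy_poly_op m n N e P :
  energy_bound e P -> energy_bound (e + n%:Z - m%:Z) (poly_op m n N P).
Proof.
move=> bP; rewrite /poly_op -[_ *: _]addr0.
apply: energy_bound_linear; last exact: energy_bound0.
have := F_dpow k (hN C k) (@modeb_linear C) (@modeb_comm C)
  (@energy_bound_linear C) (@energy_bound0 C) (@energy_bound_le C)
  (@energy_bound_neg C) (@energy_bound_max C) (@energy_bound_ptilde C)
  (@energy_bound_modeb C) N m (m + n) bP.
by apply: energy_bound_le; lia.
Qed.

Definition bmode := mode k (fun i (P : V) => bvar C i * P) (@modeb C).

Lemma bmode_linear z : linear (bmode z).
Proof.
apply: mode_linear => [i a P Q|i]; last exact: modeb_linear.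
by rewrite mulrDr scalerAr.
Qed.

Lemma bmode_gt0 (n : nat) P : (0 < n)%N -> bmode n%:Z P = ptilde C n * P.
Proof.
case: n => [//|n] _.
by rewrite /bmode /mode bvar.unlock.
Qed.

Lemma bmode_lt0 (n : nat) P : (0 < n)%N ->
  bmode (- n%:Z) P = (n%:R / k.+1%:R) *: dptilde n P.
Proof.
case: n => [//|n] _.
rewrite /bmode /mode /= modeb.unlock.
move: (dptilde n.+1 P) => Q.
by rewrite [LHS]scalerA mulrC.
Qed.

Lemma bmode_commutator (a c : int) P : a <> 0 -> c <> 0 ->
  bmode a (bmode c P) - bmode c (bmode a P) =
  (k.+1%:R^-1 * (- a)%:~R * (a == - c)%:R) *: P.
Proof.
exact: (mode_commutator k (@modeb_linear C) (@modeb_der C) (@modeb_ptilde C)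
  (@modeb_comm C) P).
Qed.

Lemma poly_op_rem_tends m L P : tends (hN C k)
  (fun N => trmul_rem bham (fun i (P : V) => bvar C i * P) N L m P)
  (trmul_lim k (fun i (P : V) => bvar C i * P) (@modeb C) L m P).
Proof.
have hE N : (0 < N)%N -> hN C k N * (k.+1%:R * N%:R) = 1.
  by move=> N_gt0; rewrite mulVf // mulf_neq0 ?pnatr_eq0 // -lt0n.
by case: (dpow_ham_tends (@modeb_linear C) (@modeb0 C) (@modeb_der C)
  (@modeb_ptilde C) (@modeb_comm C)
  (@energy_bound_linear C) (@energy_bound0 C) (@energy_bound_le C)
  (@energy_bound_neg C) (@energy_bound_max C) (@energy_bound_ptilde C)
  (@energy_bound_modeb C) hE m L) => _ _; apply.
Qed.

(** The coefficient [gbin] at L = m + n is the number of words averaged by Sym and cancels against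
    it, so the limit is a mode with coefficient 1. *)
Lemma poly_op_tends m n P : m <> n ->
  tends (hN C k) (fun N => poly_op m n N P) (bmode (n%:Z - m%:Z) P).
Proof.
move=> ne_mn; have := poly_op_rem_tends m (m + n) P.
have L_neq : (m + n == m.*2)%N = false by apply/eqP; lia.
have eq_mode : (m + n)%:Z - m.*2%:Z = n%:Z - m%:Z by lia.
rewrite /trmul_lim gbin_nat eq_mode /trmul_rem /lead L_neq.
have neq : (m == n) = false by apply/eqP.
rewrite /poly_op neq -/(btrmul) -/(bmode).
have c_neq0 : 'C(m + n, m)%:R != 0 :> C.
  by rewrite pnatr_eq0 -lt0n bin_gt0 leq_addr.
exact: (tends_unscale c_neq0).
Qed.

Lemma poly_op_diag_tends m P : tends (hN C k) (fun N => poly_op m m N P)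
  ((('C(m + m, m)%:R)^-1 * (cat C m / k.+1%:R)) *: P).
Proof.
have := poly_op_rem_tends m (m + m) P.
rewrite /trmul_rem /lead addnn eqxx mul1r /poly_op eqxx addnn.
apply: tends_rescale => N N_gt0.
by rewrite /hN invfM mulfVK // pnatr_eq0 -lt0n.
Qed.

End MatrixModelStates.

From mathcomp Require Import all_classical all_reals all_analysis complex.
Import BosonicTheory.
Import numFieldNormedType.Exports.

Definition linear_of (R : nzRingType) (U W : lmodType R) (f : U -> W)
  (linf : linear f) : {linear U -> W} :=
  HB.pack f (GRing.isLinear.Build R U W *:%R f linf).

(** * Convergence of coefficients *)

Section Limits.
Local Open Scope classical_set_scope.
Variables (C : numClosedFieldType) (k : nat).
Hypothesis nat_cofinal : forall e : C, 0 < e -> exists n : nat, e < n%:R.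

Lemma hN_cvg0 : hN C k N @[N --> \oo] --> (0 : C).
Proof.
apply/cvgr0Pnorm_lt => e e_gt0.
have [|n lt_n] := nat_cofinal (e := e^-1); first by rewrite invr_gt0.
exists n => // N /= le_nN; have N_gt : e^-1 < k.+1%:R * N%:R.
  apply: lt_le_trans lt_n _; rewrite -natrM ler_nat.
  exact: leq_trans le_nN (leq_pmull _ _).
have prod_gt0 : 0 < k.+1%:R * N%:R :> C.
  by apply: lt_trans N_gt; rewrite invr_gt0.
rewrite /hN ger0_norm ?invr_ge0 1?ltW //.
by rewrite -[e]invrK ltf_pV2 // posrE invr_gt0.
Qed.

(** Passage from algebra to analysis: a coefficient is a linear form, and each generator of [tends]
    becomes a convergence of scalar sequences because [hN] tends to 0. *)
Lemma tends_coef (x : nat -> bosonic C) l w : tends (hN C k) x l ->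
  coef w (x N) @[N --> \oo] --> coef w l.
Proof.
have coefZ a (P : bosonic C) : coef w (a *: P) = a * coef w P.
  exact: (linear_funZ (W := C^o) _ _ (coef_linear w)).
have coefD (P Q : bosonic C) : coef w (P + Q) = coef w P + coef w Q.
  by have := coef_linear w 1 P Q; rewrite scale1r mul1r.
have coef0 : coef w (0 : bosonic C) = 0.
  by rewrite -[0 in LHS](scale0r 0) coefZ mul0r.
elim=> {x l} [u|x l _ IHx|x y l l' _ IHx _ IHy|x y l eq_xy _ IHx].
- exact: cvg_cst.
- rewrite coef0 -(mul0r (coef w l)).
  have eq_fun : (fun N => coef w (hN C k N *: x N)) =
      (fun N => hN C k N * coef w (x N)).
    by apply/funext => N; exact: coefZ.
  rewrite eq_fun; apply: cvgM IHx; exact: hN_cvg0.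
- have eq_fun : (fun N => coef w (x N + y N)) =
      (fun N => coef w (x N) + coef w (y N)).
    by apply/funext => N; exact: coefD.
  by rewrite eq_fun coefD; exact: cvgD.
- apply: cvg_trans IHx; apply: near_eq_cvg.
  by exists 1%N => // N /= N_gt0; rewrite eq_xy.
Qed.

Lemma cvg_t_scaled m n (L : {linear bosonic C -> bosonic C}) :
  (forall e P, energy_bound e P -> energy_bound (e + n%:Z - m%:Z) (L P)) ->
  (forall P, tends (hN C k) (fun N => poly_op k m n N P) (L P)) ->
  cvg_large_N k m n (fun N => @t_scaled C N k m n) L.
Proof.
move=> bL limL E lt_mnE; exists (fun N => poly_op k m n N).
have eE : E%:Z + n%:Z - m%:Z = (E + n - m)%N by lia.
split=> [|P /energy_leP bP|u w _ _].
(* This threshold gives the intertwining on energies up to E and injectivity of [state] on source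
   and target, of energy at most E + n. *)
- exists (E + (m + n)).+1%N => // N /= lt_N; have N_gt0 : (0 < N)%N by lia.
  split; do 1?[by apply: state_injective => //; lia].
  move=> P /energy_leP bP; split.
    by apply/energy_leP; rewrite -eE; exact: energy_poly_op.
  by rewrite -(@t_scaled_state C k m n N E) //; lia.
- by apply/energy_leP; rewrite -eE; exact: bL.
- exact: tends_coef.
Qed.

Lemma energy_bmode e z (P : bosonic C) :
  energy_bound e P -> energy_bound (e + z) (bmode k z P).
Proof.
case: z => [[|n]|n] bP.
- exact: energy_bound0.
- exact: energy_bound_ptilde.
- rewrite /bmode /mode -[_ *: _]addr0.
  apply: energy_bound_linear (@energy_bound0 C _).
  by have := @energy_bound_modeb C n.+1 e P bP; rewrite NegzE.
Qed.

End Limits.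

Lemma complex_nat_cofinal (R : realType) (e : R[i]) : 0 < e ->
  exists n : nat, e < n%:R.
Proof.
move=> e_gt0; have eE : e = real_complex R (complex.Re e).
  by rewrite RRe_real ?gtr0_real.
exists (Num.truncn (complex.Re e)).+1.
by rewrite eE -(rmorph_nat (real_complex R)) ltcR truncnS_gt.
Qed.

Theorem theoremC (R : realType) (k : nat) (hk : (1 <= k)%N) :
  (forall m n : nat,
     exists L : {linear bosonic R[i] -> bosonic R[i]},
       cvg_large_N k m n (fun N => @t_scaled R[i] N k m n) L) /\
  (exists alpha : int -> {linear bosonic R[i] -> bosonic R[i]},
     [/\ forall m n : nat, m <> n ->
           cvg_large_N k m n (fun N => @t_scaled R[i] N k m n)
             (alpha (m%:Z - n%:Z)),
         forall (n m : int) (P : bosonic R[i]), n <> 0 -> m <> 0 ->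
           alpha n (alpha m P) - alpha m (alpha n P)
           = ((k.+1)%:R^-1 * n%:~R * (n == - m)%:R) *: P,
         forall (n : nat) (P : bosonic R[i]), (0 < n)%N ->
           alpha (- n%:Z) P = ptilde R[i] n * P &
         forall (n : nat) (P : bosonic R[i]), (0 < n)%N ->
           alpha n%:Z P = (n%:R / (k.+1)%:R) *: dptilde n P]).
Proof.
have cof := @complex_nat_cofinal R.
have Z_linear (a : R[i]) : linear ( *:%R a : bosonic R[i] -> bosonic R[i]).
  by move=> c u v; rewrite scalerDr !scalerA mulrC.
(* The sign matches the conventions: the limit for (m, n) raises the energy by n - m, while the
   index of the current is m - n. *)
pose alpha z := linear_of (@bmode_linear R[i] k (- z)).
have cvg_neq m n : m <> n -> cvg_large_N k m n
    (fun N => @t_scaled R[i] N k m n) (alpha (m%:Z - n%:Z)).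
  move=> ne_mn; apply: (cvg_t_scaled cof) => [e P bP|P].
    have := @energy_bmode R[i] k e (- (m%:Z - n%:Z)) P bP.
    by rewrite (_ : e + - (m%:Z - n%:Z) = e + n%:Z - m%:Z) //; lia.
  by have := @poly_op_tends R[i] k m n P ne_mn; rewrite -(opprB m%:Z).
split=> [m n|].
  (* For m = n the limit is a multiple of the identity, its scalar read off from
     [poly_op_diag_tends]. *)
  have [->|/eqP ne_mn] := eqVneq m n; last by eexists; exact: cvg_neq.
  eexists (linear_of (Z_linear _)); apply: (cvg_t_scaled cof) => [e P bP|P].
    rewrite addrK -[linear_of _ _]addr0; apply: energy_bound_linear bP _.
    exact: energy_bound0.
  exact: poly_op_diag_tends.
exists alpha; split=> // [n m P n_neq0 m_neq0|n P n_gt0|n P n_gt0].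
- apply: etrans (@bmode_commutator R[i] k (- n) (- m) P _ _) _.
  + by move/eqP; rewrite oppr_eq0 => /eqP.
  + by move/eqP; rewrite oppr_eq0 => /eqP.
  + by rewrite opprK eqr_oppLR opprK -eqr_oppLR.
- apply: etrans (bmode_gt0 k P n_gt0).
  by rewrite -[LHS]/(bmode k (- - n%:Z) P) opprK.
- exact: bmode_lt0.
Qed.
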